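(* Let $\Phi:\mathbb{C}^{n\times n}\to\mathbb{C}^{m\times m}$ be a completely positive map, let $\alpha\in\mathbb{R}^n$, $\beta\in\mathbb{R}^m$ be nonincreasing vectors and $k\ge0$. Then $\operatorname{cap}_k^{\alpha,\beta}\Phi>-\infty$ if and only if $\Phi$ is $k$-scalable to $(\alpha,\beta)$.
   Context: $\Phi$ has Kraus operators $A_1,\dots,A_p\in\mathbb{C}^{m\times n}$: $\Phi(X)=\sum_iA_iXA_i^\dagger$, $\Phi^*(Y)=\sum_iA_i^\dagger YA_i$; a scaling $\Phi_{B,C}$ ($B,C$ invertible) has Kraus operators $BA_iC^\dagger$; the size of a CP map $\Psi$ is $\operatorname{Tr}\Psi(I_n)$. For $x\in\mathbb{R}^d$, $x^\downarrow$ is $x$ sorted nonincreasingly; $x$ is weakly majorized by $y$, $x\preceq y$, if $\sum_{i=1}^sx_i^\downarrow\le\sum_{i=1}^sy_i^\downarrow$ for all $s$. $\lambda(H)$ is the vector of eigenvalues of a Hermitian $H$ in nonincreasing order. $\Psi$ is $(\alpha,\beta)$-majorized if $\lambda(\Psi^*(I_m))\preceq\alpha$ and $\lambda(\Psi(I_n))\preceq\beta$. $\Phi$ is $k$-scalable to $(\alpha,\beta)$ if for every $\varepsilon>0$ some scaling of $\Phi$ is $(\alpha,\beta)$-majorized and has size at least $k-\varepsilon$. With $\mathcal{D}=\{(X,Y,z):X\succeq I_n,Y\succeq I_m\text{ Hermitian},z\ge0\}$, $f_k^{\alpha,\beta}(X,Y,z)=\operatorname{Tr}\Phi(X^{-1})Y^{-1}e^z+\alpha\cdot\lambda(\log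 X)+\beta\cdot\lambda(\log Y)-kz$ and $\operatorname{cap}_k^{\alpha,\beta}\Phi=\inf_{\mathcal{D}}f_k^{\alpha,\beta}$.
   Formalization: For k = 0 the formal theorem also assumes that Φ = 0 or that the entries of α and of β both have nonzero sum; without this the claim fails, e.g. for n = m = 1, Φ = id, α = β = 0, k = 0, where the capacity is 0 but no invertible scaling is (0,0)-majorized. *)

(* Defs.v *)
From HB Require Import structures.
From mathcomp Require Import all_boot all_order all_algebra.
From mathcomp Require Import sesquilinear spectral.
From mathcomp Require Import complex.
From mathcomp Require Import all_classical all_reals all_analysis.

Set Implicit Arguments.
Unset Strict Implicit.
Unset Printing Implicit Defensive.

Import Order.TTheory GRing.Theory Num.Theory.
Local Open Scope classical_set_scope.
Local Open Scope ring_scope.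
Local Open Scope sesquilinear_scope.
Local Open Scope complex_scope.

Section Definitions.
Variable R : realType.
Local Notation C := R[i].

Section CPMaps.
Variables m n p : nat.
Implicit Type A : 'I_p -> 'M[C]_(m, n).

Definition cp_map A (X : 'M[C]_n) : 'M[C]_m :=
  \sum_(i < p) A i *m X *m (A i)^t*.

Definition cp_adjoint A (Y : 'M[C]_m) : 'M[C]_n :=
  \sum_(i < p) (A i)^t* *m Y *m A i.

(* Kraus operators of the scaling by B and D; a scaling in the proper sense
   when B and D are invertible. *)
Definition cp_scaling (B : 'M[C]_m) (D : 'M[C]_n) A : 'I_p -> 'M[C]_(m, n) :=
  fun i => B *m A i *m D^t*.

(* The trace is a (nonnegative) real number, hence the real part. *)
Definition cp_size A : R := complex.Re (\tr (cp_map A 1%:M)).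

End CPMaps.

Definition nonincreasing_vec d (x : 'rV[R]_d) : Prop :=
  forall i j : 'I_d, (i <= j)%N -> x 0 j <= x 0 i.

Definition sort_desc d (x : 'rV[R]_d) : 'rV[R]_d :=
  \row_(i < d) (sort >=%R [seq x 0 j | j <- enum 'I_d])`_i.

Definition weakly_majorized d (x y : 'rV[R]_d) : Prop :=
  forall s, (s <= d)%N ->
    \sum_(i < d | (i < s)%N) sort_desc x 0 i <=
    \sum_(i < d | (i < s)%N) sort_desc y 0 i.

Definition dotr d (x y : 'rV[R]_d) : R := \sum_(i < d) x 0 i * y 0 i.

(* For H Hermitian, spectral_diag H lists the eigenvalues of H with
   multiplicity; they are real and come in no particular order. *)
Definition eigvals d (H : 'M[C]_d) : 'rV[R]_d :=
  sort_desc (map_mx (@complex.Re R) (spectral_diag H)).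

(* Functional calculus: the principal logarithm of a positive definite X. *)
Definition logmx d (X : 'M[C]_d) : 'M[C]_d :=
  invmx (spectralmx X)
  *m diag_mx (map_mx (fun c => (ln (complex.Re c))%:C) (spectral_diag X))
  *m spectralmx X.

Definition psdmx d (H : 'M[C]_d) : Prop :=
  H \is hermsymmx /\ forall v : 'cV[C]_d, 0 <= (v^t* *m H *m v) 0 0.

Definition loewner_le d (H K : 'M[C]_d) : Prop := psdmx (K - H).

Section Capacity.
Variables m n p : nat.
Implicit Type A : 'I_p -> 'M[C]_(m, n).

Definition majorized_by A (alpha : 'rV[R]_n) (beta : 'rV[R]_m) : Prop :=
  weakly_majorized (eigvals (cp_adjoint A 1%:M)) alpha /\
  weakly_majorized (eigvals (cp_map A 1%:M)) beta.

Definition cp_scalable (k : R) A (alpha : 'rV[R]_n) (beta : 'rV[R]_m) : Prop :=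
  forall eps : R, 0 < eps ->
    exists (B : 'M[C]_m) (D : 'M[C]_n),
      [/\ B \in unitmx, D \in unitmx,
          majorized_by (cp_scaling B D A) alpha beta &
          k - eps <= cp_size (cp_scaling B D A)].

Definition cap_domain : set ('M[C]_n * 'M[C]_m * R) :=
  [set q | [/\ q.1.1 \is hermsymmx, q.1.2 \is hermsymmx,
               loewner_le 1%:M q.1.1, loewner_le 1%:M q.1.2 & 0 <= q.2]].

(* The trace of the product of two positive semidefinite matrices is real. *)
Definition cap_obj (k : R) A (alpha : 'rV[R]_n) (beta : 'rV[R]_m)
    (q : 'M[C]_n * 'M[C]_m * R) : R :=
  let: (X, Y, z) := q in
  complex.Re (\tr (cp_map A (invmx X) *m invmx Y)) * expR z
  + dotr alpha (eigvals (logmx X)) + dotr beta (eigvals (logmx Y)) - k * z.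

Definition capacity (k : R) A (alpha : 'rV[R]_n) (beta : 'rV[R]_m) : \bar R :=
  ereal_inf [set (cap_obj k A alpha beta q)%:E | q in cap_domain].

End Capacity.
End Definitions.

(* Main.v *)
Require Import Defs.
From HB Require Import structures.
From mathcomp Require Import all_boot all_order all_algebra.
From mathcomp Require Import perm.
From mathcomp Require Import sesquilinear spectral.
From mathcomp Require Import complex.
From mathcomp Require Import all_classical all_reals all_analysis.
From mathcomp Require Import ring lra.

Set Implicit Arguments.
Unset Strict Implicit.
Unset Printing Implicit Defensive.

Import Order.TTheory GRing.Theory Num.Theory.
Import numFieldNormedType.Exports.
Local Open Scope ring_scope.
Local Open Scope complex_scope.

Local Open Scope sesquilinear_scope.

(** Fix unitary eigenbases of [X] and [Y], with eigenvalues [exp x_i], [exp y_j].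
    The objective becomes
    [sum_ij a_ij exp (z - x_i - y_j) + alpha . x + beta . y - k z], where the
    weights [a_ij >= 0] are squared moduli of Kraus entries in these bases.
    Write [P_s] and [Q_s] for the partial sums of [alpha] and [beta].

    Bounded capacity implies scalability.  Boundedness along rays gives
    [P_s, Q_s >= 0] and [k <= P_n, Q_m]; outside the degenerate case all
    [P_s, Q_s] with [s > 0] are positive, and then
    [f_(k - eps) = f_k + eps z] is coercive and has a minimizer [(X, Y, z)].
    Scale by [D^* D = X^-1] and [B^* B = e^z Y^-1].  Moving [z] up shows that the
    size is at least [k - eps].  Multiplying [X] by [exp (tau G)], where [G]
    projects onto the top [s] eigenvectors of the scaled marginal, raises each
    eigenvalue of [log X] by an amount in [[0, tau]] (Weyl) with total [s tau]
    (determinant), so [alpha . lambda (log X)] grows by at most [tau P_s];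
    optimality as [tau -> 0] is the majorization.

    Scalability implies bounded capacity.  If in some bases all Kraus entries with
    [i >= c], [j >= d] vanish, the same holds after any scaling (in new bases), so
    Ky Fan's inequality and majorization give [k <= P_c + Q_d].  For the other
    pairs [(c, d)] the weight of that block is bounded below by some [delta > 0],
    by compactness of the unitary groups.  If the exponential term [W] is less
    than [delta e^M] then, for every [t], the pair
    [c = #{x_i >= t}], [d = #{y_j >= z - M - t}] is of the first kind; integrating
    [k <= P_c + Q_d] over [0 <= t <= z - M] gives
    [k (z - M) <= alpha . x + beta . y].  Hence [f >= W - k M], which is bounded
    below for [e^M = 2 W / delta]. *)

(** * Sorted vectors and partial sums *)

Section RealVectors.
Variable R : realType.
Implicit Types (d s : nat).

Definition psum d (x : 'rV[R]_d) s : R := \sum_(i < d | (i < s)%N) x 0 i.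

Definition vseq (T : Type) d (x : 'rV[T]_d) : seq T :=
  [seq x 0 j | j <- enum 'I_d].

Lemma size_vseq (T : Type) d (x : 'rV[T]_d) : size (vseq x) = d.
Proof. by rewrite size_map size_enum_ord. Qed.

Lemma nth_vseq (T : Type) x0 d (x : 'rV[T]_d) (i : 'I_d) :
  nth x0 (vseq x) i = x 0 i.
Proof. by rewrite (nth_map i) ?size_enum_ord// nth_ord_enum. Qed.

Lemma sort_desc_noninc d (x : 'rV[R]_d) : nonincreasing_vec (sort_desc x).
Proof.
move=> i j ij; rewrite !mxE.
apply: (@sorted_leq_nth _ >=%R) => //.
- by move=> a b c /= ba ac; apply: le_trans ba.
- by move=> a; exact: lexx.
- by apply: sort_sorted => a b; exact: le_total.
- by rewrite inE size_sort size_vseq.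
- by rewrite inE size_sort size_vseq.
Qed.

Lemma sort_desc_perm_eq d (x y : 'rV[R]_d) :
  perm_eq (vseq x) (vseq y) -> sort_desc x = sort_desc y.
Proof.
move=> /(@perm_sortP _ >=%R) xy; apply/rowP => i; rewrite !mxE.
congr nth; apply: xy.
- by move=> a b; apply: le_total.
- by move=> a b c /= ba ac; apply: le_trans ba.
- by move=> a b /=; rewrite andbC => /le_anti.
Qed.

Lemma sort_desc_id d (x : 'rV[R]_d) : nonincreasing_vec x -> sort_desc x = x.
Proof.
move=> xn; apply/rowP => i; rewrite mxE sorted_sort; last 2 first.
- by move=> a b c /= ba ac; apply: le_trans ba.
- apply/(sortedP 0) => j; rewrite size_vseq => jd.
  have j1d : (j < d)%N by apply: ltn_trans jd.
  rewrite (nth_vseq _ _ (Ordinal jd)) (nth_vseq _ _ (Ordinal j1d)).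
  exact: xn.
by rewrite nth_vseq.
Qed.

Lemma perm_eq_vseq (T : eqType) d (x y : 'rV[T]_d) : perm_eq (vseq x) (vseq y) ->
  exists p : {perm 'I_d}, x = \row_i y 0 (p i).
Proof.
move=> /(@tuple_permP _ _ _ [tuple y 0 i | i < d])[p xE]; exists p.
apply/rowP => i; rewrite mxE -[LHS](nth_vseq (x 0 i)) xE.
by rewrite -tnth_nth !tnth_mktuple.
Qed.

Lemma sort_desc_perm d (x : 'rV[R]_d) :
  exists p : {perm 'I_d}, sort_desc x = \row_i x 0 (p i).
Proof.
apply: perm_eq_vseq; rewrite [X in perm_eq X _](_ : _ = sort >=%R (vseq x)).
  by rewrite perm_sort.
apply: (@eq_from_nth _ 0); rewrite size_vseq ?size_sort ?size_vseq// => i id.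
by rewrite (nth_vseq _ _ (Ordinal id)) mxE.
Qed.

Lemma weakly_majorized_psum d (x y : 'rV[R]_d) :
  nonincreasing_vec x -> nonincreasing_vec y ->
  weakly_majorized x y <-> (forall s, (s <= d)%N -> psum x s <= psum y s).
Proof. by move=> xn yn; rewrite /weakly_majorized !sort_desc_id. Qed.

Lemma psum0 d (x : 'rV[R]_d) : psum x 0 = 0.
Proof. by rewrite /psum big_pred0. Qed.

Lemma psumS d (x : 'rV[R]_d) (i : 'I_d) : psum x i.+1 = psum x i + x 0 i.
Proof.
rewrite /psum (bigD1 i)//= addrC; congr (_ + _); apply: eq_bigl => j.
by rewrite ltnS [in RHS]ltn_neqAle andbC.
Qed.

Lemma psum_full d (x : 'rV[R]_d) : psum x d = \sum_i x 0 i.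
Proof. by apply: eq_bigl => i; rewrite ltn_ord. Qed.

Lemma sum_ltn_ord d s : (s <= d)%N -> \sum_(j < d) (j < s)%N%:R = s%:R :> R.
Proof.
move=> sd; rewrite (eq_bigr (fun j : 'I_d => if (j < s)%N then 1 else 0)).
  by rewrite -big_mkcond/= (big_ord_narrow sd) sumr_const card_ord.
by move=> j _; case: ltnP.
Qed.

(* The maximum of a linear functional with nonincreasing coefficients over the
   hypersimplex is attained at its first vertex. *)
Lemma hypersimplex_le_psum d (a c : 'rV[R]_d) s : nonincreasing_vec a ->
  (s <= d)%N -> (forall j, 0 <= c 0 j <= 1) -> \sum_j c 0 j = s%:R ->
  \sum_j c 0 j * a 0 j <= psum a s.
Proof.
move=> an sd c01 cs.
(* The level [t] separates the first [s] entries of [a] from the rest. Hence every term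
   [((j < s) - c j) * (a j - t)] is nonnegative, and [t] drops out of the sum because both weight
   vectors sum to [s]. *)
have [t [t1 t2]] : exists t : R, (forall j : 'I_d, (j < s)%N -> t <= a 0 j) /\
    (forall j : 'I_d, (s <= j)%N -> a 0 j <= t).
  case: (ltnP s d) => [lt_sd|ds].
    exists (a 0 (Ordinal lt_sd)); split => j js; apply: an => //=; exact: ltnW.
  case: d a c an sd c01 cs ds => [|d] a c an sd c01 cs ds.
    by exists 0; split; case.
  exists (a 0 ord_max); split => j js; first by apply: an; rewrite leq_ord.
  by have := leq_trans ds js; rewrite leqNgt ltn_ord.
have -> : psum a s = \sum_(j < d) (j < s)%N%:R * a 0 j.
  rewrite /psum big_mkcond; apply: eq_bigr => j _.
  by case: ifP; rewrite ?mul1r ?mul0r.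
have cs' := sum_ltn_ord sd.
have : \sum_(j < d) ((j < s)%N%:R - c 0 j) * (a 0 j - t) >= 0.
  apply: sumr_ge0 => j _; have /andP[c0 c1] := c01 j.
  case: ltnP => js /=.
    by apply: mulr_ge0; rewrite subr_ge0//; exact: t1.
  by rewrite sub0r mulr_le0// ?oppr_le0// subr_le0; exact: t2.
under eq_bigr do rewrite mulrBr.
rewrite sumrB -mulr_suml sumrB cs cs' subrr mul0r subr0.
under eq_bigr do rewrite mulrBl.
by rewrite sumrB subr_ge0.
Qed.

(** Summation by parts: a nonincreasing nonnegative vector is a nonnegative combination of
    indicators of initial segments, and [dotr a] of such an indicator is a partial sum of [a]. *)
Lemma dotr_abel d (a x : 'rV[R]_d) : nonincreasing_vec x ->
  (forall i, 0 <= x 0 i) -> (forall s, (s <= d)%N -> 0 <= psum a s) ->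
  0 <= dotr a x.
Proof.
move=> xn x0 a0.
(* The free lower bound [y] is what makes the induction work: the hypothesis is used at the last
   entry, and passing from that entry down to [y] costs a nonnegative multiple of the next partial
   sum. *)
have H s (sd : (s <= d)%N) : forall y, (forall i : 'I_d, (i < s)%N -> y <= x 0 i) ->
    psum a s * y <= \sum_(i < d | (i < s)%N) a 0 i * x 0 i.
  elim: s sd => [|s IH] sd y yx; first by rewrite psum0 mul0r big_pred0.
  pose i := Ordinal sd.
  rewrite (bigD1 i)//= -[X in psum a X]/(nat_of_ord i).+1 psumS mulrDl.
  have -> : \sum_(j < d | (j < s.+1)%N && (j != i)) a 0 j * x 0 j =
      \sum_(j < d | (j < s)%N) a 0 j * x 0 j.
    apply: eq_bigl => j; rewrite ltnS andbC -[j != i]/(val j != s).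
    by rewrite -ltn_neqAle.
  have yi : y <= x 0 i by apply: yx.
  have := IH (ltnW sd) (x 0 i) (fun j ji => xn j i (ltnW ji)).
  have := a0 _ sd; rewrite -[s.+1]/(nat_of_ord i).+1 psumS /=.
  move: (psum a s) => P; nra.
have := H d (leqnn d) 0 (fun i _ => x0 i); rewrite mulr0.
move=> /le_trans; apply; rewrite /dotr big_mkcond/=.
by under eq_bigr do rewrite ltn_ord.
Qed.

(** Subtracting [c] from the first entry of [a] lowers each [psum a s] with [s > 0] by [c], so
    [dotr_abel] still applies and [dotr a x] is at least [c] times the largest entry of [x]. This is
    the coercivity estimate used for the minimizer. *)
Lemma dotr_ge_entry d (a x : 'rV[R]_d) c : 0 <= c -> nonincreasing_vec x ->
  (forall i, 0 <= x 0 i) -> (forall s, (0 < s <= d)%N -> c <= psum a s) ->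
  forall i : 'I_d, c * x 0 i <= dotr a x.
Proof.
case: d a x => [|d] a x c0 xn x0 ac i; first by case: i.
have -> : dotr a x = dotr (a - c *: delta_mx 0 0) x + c * x 0 0.
  rewrite /dotr; under [X in X + _]eq_bigr do rewrite !mxE eqxx/= mulrBl.
  rewrite sumrB (_ : \sum_(i < d.+1) c * _ * _ = c * x 0 0) ?subrK//.
  rewrite (bigD1 0)//= mulr1 big1 ?addr0// => j j0.
  by rewrite (negbTE j0) mulr0 mul0r.
rewrite -[leLHS]add0r lerD//; last by rewrite ler_wpM2l// xn.
apply: dotr_abel => // -[|s] sd; first by rewrite psum0.
rewrite /psum; under eq_bigr do rewrite !mxE eqxx/=.
rewrite sumrB (_ : \sum_(i < d.+1 | _) c * _ = c).
  by rewrite subr_ge0; exact: ac.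
rewrite (bigD1 0)//= mulr1 big1 ?addr0// => j /andP[_ j0].
by rewrite (negbTE j0) mulr0.
Qed.
End RealVectors.

(** * Superlevel sets of monotone vectors and the layer-cake bound *)

Section Layers.
Variable R : realType.

(** Breakpoints are removed one at a time by splitting the interval there. It stands in for
    integrating a piecewise constant slope. *)
Lemma piecewise_nondecreasing (phi : R -> R) (a b : R) (bp : seq R) :
  (forall s t, a <= s -> s <= t -> t <= b ->
     (forall p, p \in bp -> p <= s \/ t <= p) -> phi s <= phi t) ->
  forall s t, a <= s -> s <= t -> t <= b -> phi s <= phi t.
Proof.
elim: bp => [|p bp IH] H; first by move=> s t *; exact: H.
apply: IH => s t as_ st tb clear.
have [ps|sp] := leP p s.
  by apply: H => // q; rewrite inE => /orP[/eqP->|/clear]; [left|].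
have [tp|pt] := leP t p.
  by apply: H => // q; rewrite inE => /orP[/eqP->|/clear]; [right|].
apply: (@le_trans _ _ (phi p)).
  apply: H; rewrite ?(ltW sp)//; first exact: le_trans (ltW pt) tb.
  move=> q; rewrite inE => /orP[/eqP->|/clear]; first by right.
  by move=> [?|tq]; [left|right; apply: le_trans tq; apply: ltW].
apply: H; rewrite ?(ltW pt)//; first exact: le_trans (ltW sp).
move=> q; rewrite inE => /orP[/eqP->|/clear]; first by left.
by move=> [qs|tq]; [left; apply: le_trans qs _; apply: ltW|right].
Qed.

Lemma noninc_threshold d (x : 'rV[R]_d) (t : R) : nonincreasing_vec x ->
  exists2 c, (c <= d)%N & forall i : 'I_d, (i < c)%N = (t <= x 0 i).
Proof.
move=> xn; pose a (v : R) := v < t; exists (find a (vseq x)).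
  by rewrite -{2}(size_vseq x) find_size.
move=> i; case: ltnP => ic.
  have := before_find 0 ic; rewrite nth_vseq /a => /negbT.
  by rewrite -leNgt => ->.
have cd : (find a (vseq x) < d)%N by apply: leq_ltn_trans ic _.
have := xn (Ordinal cd) i ic.
have : has a (vseq x) by rewrite has_find size_vseq.
move=> /(nth_find 0); rewrite (nth_vseq 0 x (Ordinal cd)) /a => xt ix.
by apply/esym/negbTE; rewrite -ltNge; apply: le_lt_trans xt.
Qed.

Lemma psum_indicator d (a g : 'rV[R]_d) c (h : R) :
  (forall i : 'I_d, g 0 i = if (i < c)%N then h else 0) ->
  \sum_i a 0 i * g 0 i = h * psum a c.
Proof.
move=> gE; rewrite /psum [in RHS]big_mkcond mulr_sumr; apply: eq_bigr => i _.
by rewrite gE; case: ifP; rewrite ?mulr0// mulrC.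
Qed.

(* Layer-cake argument: [k] is below the slope, in the truncation level [t], of
   [alpha . min(x, t) - beta . min(y, L - t)], which is integrated over
   [0 <= t <= L]. *)
Lemma layers_le_dotr n m (alpha x : 'rV[R]_n) (beta y : 'rV[R]_m) (k L : R) :
  nonincreasing_vec x -> nonincreasing_vec y ->
  (forall i, 0 <= x 0 i) -> (forall j, 0 <= y 0 j) ->
  (forall s, (s <= n)%N -> 0 <= psum alpha s) ->
  (forall s, (s <= m)%N -> 0 <= psum beta s) ->
  0 <= L ->
  (forall c d t, (c <= n)%N -> (d <= m)%N ->
     (forall i : 'I_n, (i < c)%N = (t <= x 0 i)) ->
     (forall j : 'I_m, (j < d)%N = (L - t <= y 0 j)) ->
     k <= psum alpha c + psum beta d) ->
  k * L <= dotr alpha x + dotr beta y.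
Proof.
move=> xn yn x0 y0 P0 Q0 L0 H.
(* Between consecutive breakpoints [phi] is affine with slope [psum alpha c + psum beta d - k],
   where [c] and [d] count the entries above the levels [t] and [L - t]. The breakpoints are the
   [x_i] and the [L - y_j]. *)
pose phi t := \sum_i alpha 0 i * Num.min (x 0 i) t
  - \sum_j beta 0 j * Num.min (y 0 j) (L - t) - k * t.
have : phi 0 <= phi L.
  apply: (@piecewise_nondecreasing phi 0 L
    (vseq x ++ [seq L - v | v <- vseq y])) => // s t s0 st tL clear.
  have [->//|lt_st] := eqVneq s t.
  have {}lt_st : s < t by rewrite lt_neqAle lt_st.
  have clx i : x 0 i <= s \/ t <= x 0 i.
    by apply: clear; rewrite mem_cat; apply/orP; left; apply: map_f; rewrite mem_enum.
  have cly j : y 0 j <= L - t \/ L - s <= y 0 j.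
    have [||] := clear (L - y 0 j); last 2 first.
    - by move=> ?; right; lra.
    - by move=> ?; left; lra.
    rewrite mem_cat; apply/orP; right; apply: map_f.
    by apply: map_f; rewrite mem_enum.
  (* The midpoint lies strictly inside the piece, so no entry sits on its level and the counts taken
     there are valid on the whole piece. *)
  pose u := (s + t) / 2.
  have [c cn cE] := noninc_threshold u xn.
  have [d dm dE] := noninc_threshold (L - u) yn.
  have kcd := H c d u cn dm cE dE.
  have e1 : \sum_i alpha 0 i * (\row_i (Num.min (x 0 i) t - Num.min (x 0 i) s)) 0 i
      = (t - s) * psum alpha c.
    apply: psum_indicator => i; rewrite mxE cE /u.
    have [h|h] := clx i; case: leP => h'; rewrite /Num.min;
      case: ltP => ?; case: ltP => ?; lra.
  have e2 : \sum_j beta 0 j *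
      (\row_j (Num.min (y 0 j) (L - s) - Num.min (y 0 j) (L - t))) 0 j
      = (t - s) * psum beta d.
    apply: psum_indicator => j; rewrite mxE dE /u.
    have [h|h] := cly j; case: leP => h'; rewrite /Num.min;
      case: ltP => ?; case: ltP => ?; lra.
  move: e1 e2.
  under eq_bigr do rewrite mxE mulrBr.
  rewrite sumrB => e1.
  under eq_bigr do rewrite mxE mulrBr.
  rewrite sumrB /phi => e2.
  have : (t - s) * k <= (t - s) * (psum alpha c + psum beta d).
    by rewrite ler_wpM2l// subr_ge0.
  lra.
rewrite /phi mulr0 !subr0 subrr.
have -> : \sum_i alpha 0 i * Num.min (x 0 i) 0 = 0.
  by apply: big1 => i _; rewrite min_r// mulr0.
have -> : \sum_i beta 0 i * Num.min (y 0 i) 0 = 0.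
  by apply: big1 => i _; rewrite min_r// mulr0.
(* The part of [v] cut off at level [L] is again nonincreasing and nonnegative, so truncation can
   only lower the product with [a]. *)
have trunc d (a v : 'rV[R]_d) : nonincreasing_vec v -> (forall i, 0 <= v 0 i) ->
    (forall s, (s <= d)%N -> 0 <= psum a s) ->
    \sum_i a 0 i * Num.min (v 0 i) L <= dotr a v.
  move=> vn v0 a0.
  have : 0 <= dotr a (\row_i (v 0 i - Num.min (v 0 i) L)).
    apply: dotr_abel => // [i j ij|i]; rewrite !mxE.
      have := vn _ _ ij; rewrite /Num.min; case: ltP => ?; case: ltP => ?; lra.
    by rewrite /Num.min; case: ltP => ?; lra.
  rewrite /dotr; under eq_bigr do rewrite mxE mulrBr.
  by rewrite sumrB subr_ge0.
have := trunc _ _ _ xn x0 P0; have := trunc _ _ _ yn y0 Q0; lra.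
Qed.
End Layers.

(** * Spectral decompositions *)

Section Adjoint.
Variable C : numClosedFieldType.

Lemma trmxC_mul m n p (A : 'M[C]_(m, n)) (B : 'M[C]_(n, p)) :
  (A *m B)^t* = B^t* *m A^t*.
Proof. by rewrite trmx_mul map_mxM. Qed.

Lemma trmxCD m n (A B : 'M[C]_(m, n)) : (A + B)^t* = A^t* + B^t*.
Proof. by rewrite linearD map_mxD. Qed.

Lemma trmxCZ m n a (A : 'M[C]_(m, n)) : (a *: A)^t* = Num.conj a *: A^t*.
Proof. by apply/matrixP => i j; rewrite !mxE rmorphM. Qed.

Lemma trmxC1 n : (1%:M : 'M[C]_n)^t* = 1%:M.
Proof. by rewrite trmx1 map_mx1. Qed.

Lemma trmxC_sum m n (I : finType) (F : I -> 'M[C]_(m, n)) :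
  (\sum_i F i)^t* = \sum_i (F i)^t*.
Proof. by rewrite linear_sum; apply: (raddf_sum (map_mx Num.conj)). Qed.

Lemma hermsymmxP n (H : 'M[C]_n) : reflect (H^t* = H) (H \is hermsymmx).
Proof.
by apply: (iffP (is_hermitianmxP _ _ _)); rewrite expr0 scale1r.
Qed.

Lemma unitarymx_mulVmx n (U : 'M[C]_n) : U \is unitarymx -> U^t* *m U = 1%:M.
Proof. by move=> /unitarymxP /mulmx1C. Qed.

(* The transposed Gram-Schmidt process, i.e., the QR decomposition. *)
Lemma unitary_triangularization n (M : 'M[C]_n) :
  exists2 Z, Z \is unitarymx &
    forall i j : 'I_n, (j < i)%N -> (Z *m M) i j = 0.
Proof.
pose Z := schmidt (M^t*); have Zu : Z \is unitarymx by exact: schmidt_unitarymx.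
exists Z => // i j ji.
(* Row [j] of [M^t*] is a combination of the Gram-Schmidt rows with index at most [j], all
   orthogonal to row [i] because [j < i]. *)
have /sub_sums_genmxP[w rowE] := row_schmidt_sub (M^t*) j.
suff : (M^t* *m Z^t*) j i = 0.
  move=> e; rewrite [Z *m M](_ : _ = (M^t* *m Z^t*)^t*).
    by rewrite 2!mxE e conjC0.
  by rewrite trmxC_mul !trmxCK.
have /rowP/(_ i) := congr1 (mulmx^~ (Z^t*)) rowE.
rewrite -row_mul mxE => ->; rewrite mulmx_suml summxE big1// => k kj.
rewrite -mulmxA -row_mul (unitarymxP Zu) row1 !mxE big_ord1 !mxE.
rewrite eqxx /= [i == k](_ : _ = false) ?mulr0//.
by apply/eqP => ik; rewrite -ik leqNgt ji in kj.
Qed.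

(** Both sides have the same characteristic polynomial, whose roots with multiplicity are the
    diagonal entries. *)
Lemma diag_similar_perm n (U V : 'M[C]_n) (d e : 'rV[C]_n) :
  U \is unitarymx -> V \is unitarymx ->
  U^t* *m diag_mx d *m U = V^t* *m diag_mx e *m V ->
  perm_eq (vseq d) (vseq e).
Proof.
have char (W : 'M[C]_n) (f : 'rV[C]_n) : W \is unitarymx ->
    char_poly (W^t* *m diag_mx f *m W) = \prod_(x <- vseq f) ('X - x%:P).
  move=> Wu; rewrite /char_poly; have -> : char_poly_mx (W^t* *m diag_mx f *m W) =
      map_mx polyC (W^t*) *m char_poly_mx (diag_mx f) *m map_mx polyC W.
    rewrite /char_poly_mx mulmxBr mulmxBl !map_mxM scalar_mxC -[X in _ = X - _]mulmxA.
    rewrite (_ : map_mx polyC (W^t*) *m map_mx polyC W = 1%:M) ?mulmx1//.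
    by rewrite -map_mxM unitarymx_mulVmx// map_mx1.
  rewrite !det_mulmx mulrC mulrA -det_mulmx -map_mxM.
  rewrite (unitarymxP Wu) map_mx1 det1 mul1r.
  rewrite -/(char_poly (diag_mx f)) char_poly_trig ?diag_mx_is_trig//.
  rewrite /vseq big_map big_enum; apply: eq_bigr => i _.
  by rewrite mxE eqxx mulr1n.
by move=> Uu Vu /(congr1 char_poly); rewrite !char// => /prod_XsubC_eq.
Qed.
End Adjoint.

(** * Hermitian matrices given by a unitary basis and real eigenvalues *)

Section Spectral.
Variable R : realType.
Local Notation C := R[i].

(** For unitary [U] the eigenvectors are the columns of [U^t*]. The eigenvalues form a real vector,
    so that all spectral estimates take place in [R]. *)
Definition udiag d (U : 'M[C]_d) (x : 'rV[R]_d) : 'M[C]_d :=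
  U^t* *m diag_mx (map_mx (real_complex R) x) *m U.

Lemma udiagE d (U : 'M[C]_d) x :
  udiag U x = U^t* *m diag_mx (map_mx (real_complex R) x) *m U.
Proof. by []. Qed.

Lemma vseq_map (S T : Type) (f : S -> T) d (x : 'rV[S]_d) :
  vseq (map_mx f x) = map f (vseq x).
Proof. by rewrite /vseq -map_comp; apply: eq_map => i /=; rewrite mxE. Qed.

Lemma Re_real_complex (x : R) : complex.Re (x%:C) = x. Proof. by []. Qed.

Lemma udiag_herm d (U : 'M[C]_d) (x : 'rV[R]_d) : udiag U x \is hermsymmx.
Proof.
apply/hermsymmxP; rewrite !trmxC_mul trmxCK mulmxA tr_diag_mx map_diag_mx.
congr (_ *m diag_mx _ *m _); apply/rowP => i; rewrite !mxE.
exact: conjc_real.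
Qed.

Lemma udiagB d (U : 'M[C]_d) (x y : 'rV[R]_d) : udiag U (x - y) = udiag U x - udiag U y.
Proof. by rewrite /udiag map_mxB linearB mulmxBr mulmxBl. Qed.

Lemma udiagZ d (U : 'M[C]_d) a (x : 'rV[R]_d) : udiag U (a *: x) = a%:C *: udiag U x.
Proof.
rewrite /udiag scalemxAl scalemxAr; congr (_ *m _ *m _).
by apply/matrixP => i j; rewrite !mxE rmorphM/= mulrnAr.
Qed.

Lemma udiag1 d (U : 'M[C]_d) : U \is unitarymx -> udiag U (const_mx 1) = 1%:M.
Proof.
by move=> Uu; rewrite /udiag map_const_mx diag_const_mx mulmx1 unitarymx_mulVmx.
Qed.

Lemma udiagM d (U : 'M[C]_d) (x y : 'rV[R]_d) : U \is unitarymx ->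
  udiag U x *m udiag U y = udiag U (\row_i (x 0 i * y 0 i)).
Proof.
move=> Uu; have UM (F G : 'M[C]_d) :
    (U^t* *m F *m U) *m (U^t* *m G *m U) = U^t* *m (F *m G) *m U.
  rewrite !mulmxA -(mulmxA (U^t* *m F) U (U^t*)) (unitarymxP Uu) mulmx1.
  by rewrite -(mulmxA (U^t*) F G).
rewrite /udiag UM mulmx_diag; congr (_ *m diag_mx _ *m _).
by apply/rowP => i; rewrite !mxE rmorphM.
Qed.

Lemma udiag_inv d (U : 'M[C]_d) (x : 'rV[R]_d) :
  U \is unitarymx -> (forall i, x 0 i != 0) ->
  invmx (udiag U x) = udiag U (\row_i (x 0 i)^-1).
Proof.
move=> Uu x0; have e : udiag U x *m udiag U (\row_i (x 0 i)^-1) = 1%:M.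
  rewrite udiagM// -(udiag1 Uu); congr udiag.
  by apply/rowP => i; rewrite !mxE mulfV.
have [xu _] := mulmx1_unit e.
by rewrite -[RHS](mulKmx xu) e mulmx1.
Qed.

Lemma herm_spectralE d (H : 'M[C]_d) : H \is hermsymmx ->
  H = (spectralmx H)^t* *m diag_mx (spectral_diag H) *m spectralmx H.
Proof.
move=> /hermitian_normalmx /orthomx_spectralP {1}->.
by rewrite invmx_unitary ?spectral_unitarymx.
Qed.

Lemma spectral_diag_udiag d (U : 'M[C]_d) (x : 'rV[R]_d) : U \is unitarymx ->
  perm_eq (vseq (spectral_diag (udiag U x))) (vseq (map_mx (real_complex R) x)).
Proof.
move=> Uu; apply: (diag_similar_perm (spectral_unitarymx (udiag U x)) Uu).
by rewrite -herm_spectralE ?udiag_herm.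
Qed.

Lemma eigvals_udiag_sort d (U : 'M[C]_d) (x : 'rV[R]_d) : U \is unitarymx ->
  eigvals (udiag U x) = sort_desc x.
Proof.
move=> /(spectral_diag_udiag x) p; apply: sort_desc_perm_eq.
rewrite vseq_map; apply: perm_trans (perm_map _ p) _.
by rewrite vseq_map -map_comp map_id_in.
Qed.

Lemma eigvals_udiag d (U : 'M[C]_d) (x : 'rV[R]_d) : U \is unitarymx ->
  nonincreasing_vec x -> eigvals (udiag U x) = x.
Proof. by move=> Uu xn; rewrite eigvals_udiag_sort// sort_desc_id. Qed.

Lemma eigvals_noninc d (H : 'M[C]_d) : nonincreasing_vec (eigvals H).
Proof. exact: sort_desc_noninc. Qed.

(** Permuting the rows of [spectralmx H] by a sorting permutation keeps it unitary and puts the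
    eigenvalues in nonincreasing order. *)
Lemma spectral_sorted d (H : 'M[C]_d) : H \is hermsymmx ->
  exists2 U, U \is unitarymx & H = udiag U (eigvals H).
Proof.
move=> Hh; have [p pE] := sort_desc_perm (map_mx (@complex.Re R) (spectral_diag H)).
have Pu := spectral_unitarymx H.
exists (row_perm p (spectralmx H)).
  rewrite row_permE; apply: mul_unitarymx; last exact: Pu.
  apply/unitarymxP; rewrite tr_perm_mx map_perm_mx -perm_mxM.
  by rewrite mulgV perm_mx1.
rewrite {1}[H]herm_spectralE//.
rewrite /udiag /eigvals pE row_permE trmxC_mul tr_perm_mx map_perm_mx.
rewrite !mulmxA; congr (_ *m _); rewrite -!mulmxA; congr (_ *m _).
rewrite -row_permE -[X in _ *m perm_mx X]invgK -col_permE; apply/matrixP => i j.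
rewrite !mxE (inj_eq perm_inj) permKV RRe_real//.
exact: (mxOverP (hermitian_spectral_diag_real Hh)).
Qed.

(** [logmx] uses the eigenbasis chosen by [spectralmx], which may differ from [U]; only the multiset
    of eigenvalues matters, and that does not depend on the basis. *)
Lemma eigvals_logmx d (U : 'M[C]_d) (x : 'rV[R]_d) :
  U \is unitarymx -> nonincreasing_vec x ->
  eigvals (logmx (udiag U (map_mx expR x))) = x.
Proof.
move=> Uu xn; set X := udiag _ _; rewrite /logmx invmx_unitary ?spectral_unitarymx//.
pose l := map_mx (fun c : C => ln (complex.Re c)) (spectral_diag X).
have -> : map_mx (fun c : C => (ln (complex.Re c))%:C) (spectral_diag X)
  = map_mx (real_complex R) l by apply/rowP => i; rewrite !mxE.
rewrite -/(udiag _ _) eigvals_udiag_sort ?spectral_unitarymx//.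
rewrite -[RHS]sort_desc_id//; apply: sort_desc_perm_eq.
rewrite vseq_map; apply: perm_trans (perm_map _ (spectral_diag_udiag _ Uu)) _.
by rewrite !vseq_map -2!map_comp map_id_in// => y _ /=; rewrite expRK.
Qed.

Definition normsq (z : C) : R := complex.Re z ^+ 2 + complex.Im z ^+ 2.

Lemma normsqE (z : C) : (normsq z)%:C = z * z^*.
Proof. by rewrite add_Re2_Im2 sqr_normc. Qed.

Lemma normsq_ge0 (z : C) : 0 <= normsq z.
Proof. by rewrite addr_ge0 ?sqr_ge0. Qed.

Lemma normsq_eq0 (z : C) : normsq z = 0 -> z = 0.
Proof.
case: z => a b /eqP; rewrite /normsq /= paddr_eq0 ?sqr_ge0// !sqrf_eq0.
by move=> /andP[/eqP-> /eqP->].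
Qed.

Lemma quad_udiag d (U : 'M[C]_d) (x : 'rV[R]_d) (v : 'cV[C]_d) :
  (v^t* *m udiag U x *m v) 0 0 = (\sum_i x 0 i * normsq ((U *m v) i 0))%:C.
Proof.
rewrite /udiag !mulmxA -trmxC_mul -mulmxA mxE rmorph_sum; apply: eq_bigr => i _.
rewrite mul_mx_diag !mxE rmorphM/= normsqE.
by rewrite mulrAC mulrC [X in _ * X]mulrC mulrA.
Qed.

Lemma quad1 d (v : 'cV[C]_d) :
  (v^t* *m v) 0 0 = (\sum_i normsq (v i 0))%:C.
Proof.
have u1 : (1%:M : 'M[C]_d) \is unitarymx by apply/unitarymxP; rewrite trmxC1 mulmx1.
rewrite -[X in X *m _]mulmx1 -(udiag1 u1) quad_udiag mul1mx; congr (_%:C).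
by apply: eq_bigr => i _; rewrite mxE mul1r.
Qed.

Lemma psd_udiag d (U : 'M[C]_d) (x : 'rV[R]_d) : U \is unitarymx ->
  psdmx (udiag U x) <-> (forall i, 0 <= x 0 i).
Proof.
move=> Uu; split => [[_ /(_ _)]h i|x0].
  have := h (U^t* *m delta_mx i 0).
  rewrite quad_udiag ler0c mulmxA (unitarymxP Uu) mul1mx (bigD1 i)//= big1.
    by rewrite !mxE !eqxx /normsq /= expr1n expr0n /= !addr0 mulr1.
  by move=> j ji; rewrite !mxE (negbTE ji) /normsq /= expr0n /= addr0 mulr0.
split => [|v]; first exact: udiag_herm.
by rewrite quad_udiag ler0c sumr_ge0// => i _; rewrite mulr_ge0 ?normsq_ge0.
Qed.

Lemma loewner1_udiag d (U : 'M[C]_d) (x : 'rV[R]_d) : U \is unitarymx ->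
  loewner_le 1%:M (udiag U x) <-> (forall i, 1 <= x 0 i).
Proof.
move=> Uu; rewrite /loewner_le -(udiag1 Uu) -udiagB psd_udiag//.
by split => h i; have := h i; rewrite !mxE subr_ge0.
Qed.

Lemma exp_udiag_of_loewner1 d (X : 'M[C]_d) : X \is hermsymmx ->
  loewner_le 1%:M X ->
  exists U x, [/\ U \is unitarymx, nonincreasing_vec x,
    forall i, 0 <= x 0 i & X = udiag U (map_mx expR x)].
Proof.
move=> Xh; have [U Uu XE] := spectral_sorted Xh.
move: (eigvals X) (eigvals_noninc X) XE => e en ->.
rewrite loewner1_udiag// => e1.
have e0 i : 0 < e 0 i by apply: lt_le_trans (e1 i).
exists U, (map_mx (@ln R) e); split; [exact: Uu|move=> i j ij|move=> i|].
- by rewrite !mxE ler_ln ?posrE//; exact: en.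
- by rewrite mxE ln_ge0.
- by congr udiag; apply/rowP => i; rewrite !mxE lnK ?posrE.
Qed.

Lemma loewner1_exp_udiag d (U : 'M[C]_d) (x : 'rV[R]_d) : U \is unitarymx ->
  (forall i, 0 <= x 0 i) -> loewner_le 1%:M (udiag U (map_mx expR x)).
Proof.
by move=> Uu x0; apply/loewner1_udiag => // i; rewrite mxE -expR0 ler_expR.
Qed.

End Spectral.

Global Opaque udiag.

(** * Eigenvalue inequalities *)

Section Inequalities.
Variable R : realType.
Local Notation C := R[i].

Lemma psdmxD d (H K : 'M[C]_d) : psdmx H -> psdmx K -> psdmx (H + K).
Proof.
move=> [/hermsymmxP Hh H0] [/hermsymmxP Kh K0]; split => [|v].
  by apply/hermsymmxP; rewrite trmxCD Hh Kh.
by rewrite mulmxDr mulmxDl mxE addr_ge0.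
Qed.

Lemma psdmx_congr d (H A : 'M[C]_d) : psdmx H -> psdmx (A *m H *m A^t*).
Proof.
move=> [/hermsymmxP Hh H0]; split => [|v].
  by apply/hermsymmxP; rewrite !trmxC_mul trmxCK Hh mulmxA.
have := H0 (A^t* *m v); rewrite trmxC_mul trmxCK.
by rewrite !mulmxA.
Qed.

Lemma loewner_le_trans d (H K L : 'M[C]_d) :
  loewner_le H K -> loewner_le K L -> loewner_le H L.
Proof.
move=> HK KL; have : L - H = (L - K) + (K - H) by rewrite addrA subrK.
by rewrite /loewner_le => ->; exact: psdmxD KL HK.
Qed.

Lemma sum_normsq_unitary d (U : 'M[C]_d) (v : 'cV[C]_d) : U \is unitarymx ->
  \sum_i normsq ((U *m v) i 0) = \sum_i normsq (v i 0).
Proof.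
move=> Uu; apply: (@complexI R); rewrite -quad1.
by rewrite trmxC_mul !mulmxA -[_ *m U]mulmxA unitarymx_mulVmx// mulmx1 quad1.
Qed.

Lemma sum_normsq_row d (U : 'M[C]_d) i : U \is unitarymx ->
  \sum_j normsq (U i j) = 1.
Proof.
move=> /unitarymxP/matrixP/(_ i i); rewrite !mxE eqxx => e.
apply: (@complexI R); rewrite rmorph_sum /= -[RHS]e.
by apply: eq_bigr => j _; rewrite normsqE !mxE.
Qed.

Lemma normsqJ (z : C) : normsq (z^*) = normsq z.
Proof. by case: z => a b; rewrite /normsq /= sqrrN. Qed.

Lemma sum_normsq_col d (U : 'M[C]_d) j : U \is unitarymx ->
  \sum_i normsq (U i j) = 1.
Proof.
move=> Uu; rewrite -(@sum_normsq_row _ (U^t*) j) ?trmxC_unitary//.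
by apply: eq_bigr => i _; rewrite !mxE normsqJ.
Qed.

Lemma conj_udiagE d (W V : 'M[C]_d) (e : 'rV[R]_d) i :
  (W *m udiag V e *m W^t*) i i =
  (\sum_j e 0 j * normsq ((W *m V^t*) i j))%:C.
Proof.
have -> : W *m udiag V e *m W^t* =
    (W *m V^t*) *m diag_mx (map_mx (real_complex R) e) *m (W *m V^t*)^t*.
  by rewrite udiagE trmxC_mul trmxCK !mulmxA.
move: (W *m V^t*) => M; rewrite mul_mx_diag mxE rmorph_sum; apply: eq_bigr => j _.
by rewrite !mxE rmorphM/= normsqE mulrAC mulrC.
Qed.

(** In an eigenbasis of [H] the diagonal of [W *m H *m W^t*] is the image of the spectrum under the
    squared moduli of a unitary matrix. Rows and columns of these sum to [1], so the first [s] rows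
    add up to a point of the hypersimplex. *)
Lemma ky_fan d (H W : 'M[C]_d) s : H \is hermsymmx -> W \is unitarymx ->
  (s <= d)%N ->
  \sum_(i < d | (i < s)%N) complex.Re ((W *m H *m W^t*) i i) <= psum (eigvals H) s.
Proof.
move=> Hh Wu sd; have [V Vu HE] := spectral_sorted Hh.
move: (eigvals H) (eigvals_noninc H) HE => e en ->.
have Vtu : V^t* \is unitarymx by rewrite trmxC_unitary.
have Mu : W *m V^t* \is unitarymx := mul_unitarymx Wu Vtu.
under eq_bigr do rewrite conj_udiagE Re_real_complex.
rewrite exchange_big/=; set M := W *m V^t* in Mu *.
pose c := \row_j (\sum_(i < d | (i < s)%N) normsq (M i j)).
rewrite (eq_bigr (fun j => c 0 j * e 0 j)); last first.
  by move=> j _; rewrite mxE -mulr_sumr mulrC.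
apply: hypersimplex_le_psum => // [j|].
  rewrite mxE sumr_ge0/=; last by move=> *; exact: normsq_ge0.
  rewrite -(sum_normsq_col j Mu) big_mkcond ler_sum// => i _.
  by case: ifP => // _; exact: normsq_ge0.
under eq_bigr do rewrite mxE.
rewrite exchange_big/= -(sum_ltn_ord _ sd) big_mkcond; apply: eq_bigr => i _.
by rewrite (sum_normsq_row _ Mu); case: ltnP.
Qed.

(* Courant-Fischer: the top [i+1] eigenvectors of [H] and the bottom [d-i]
   eigenvectors of [K] span subspaces with a common nonzero vector. *)
Lemma weyl_monotone d (H K : 'M[C]_d) : H \is hermsymmx -> K \is hermsymmx ->
  loewner_le H K -> forall i, eigvals H 0 i <= eigvals K 0 i.
Proof.
move=> Hh Kh [_ HK] i; have [U Uu HE] := spectral_sorted Hh.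
have [V Vu KE] := spectral_sorted Kh.
move: (eigvals H) (eigvals_noninc H) HE => h hn HE.
move: (eigvals K) (eigvals_noninc K) KE => k kn KE.
(* The zero row [i] makes [E] singular. A kernel vector has no component along the eigenvectors of
   [H] after index [i] nor along those of [K] before index [i]. *)
pose E := \matrix_(l, c) if (l < i)%N then V l c else if (i < l)%N then U l c else 0.
have : \det E^T = 0.
  rewrite det_tr (expand_det_row _ i) big1// => j _.
  by rewrite mxE ltnn mul0r.
move=> /eqP/det0P[v v0 vE].
have Ev : E *m v^T = 0 by rewrite -[E]trmxK -trmx_mul vE trmx0.
pose w := v^T.
have Uw (l : 'I_d) : (i < l)%N -> (U *m w) l 0 = 0.
  move=> il; have /matrixP/(_ l 0) := Ev; rewrite !mxE => {2}<-.
  by apply: eq_bigr => j _; rewrite [E _ _]mxE ltnNge (ltnW il) /= il.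
have Vw (l : 'I_d) : (l < i)%N -> (V *m w) l 0 = 0.
  move=> il; have /matrixP/(_ l 0) := Ev; rewrite !mxE => {2}<-.
  by apply: eq_bigr => j _; rewrite [E _ _]mxE il.
have := HK w; rewrite mulmxBr mulmxBl mxE [X in _ + X]mxE HE KE !quad_udiag.
rewrite -rmorphB ler0c subr_ge0 => le_quad.
have n0 : 0 < \sum_l normsq (w l 0).
  rewrite lt0r sumr_ge0 ?andbT; last by move=> *; exact: normsq_ge0.
  apply: contra v0 => /eqP/psumr_eq0P e; apply/eqP/rowP => l.
  have /normsq_eq0 := e (fun _ _ => normsq_ge0 _) l isT.
  by rewrite !mxE.
rewrite -(ler_pM2r n0) -{1}(sum_normsq_unitary w Uu) -(sum_normsq_unitary w Vu).
rewrite !mulr_sumr; apply: le_trans (le_trans le_quad _); apply: ler_sum => l _.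
  have [li|/Uw->] := leqP l i; first by rewrite ler_wpM2r ?normsq_ge0// hn.
  by rewrite /normsq /= expr0n /= addr0 !mulr0.
have [li|/Vw->] := leqP i l; first by rewrite ler_wpM2r ?normsq_ge0// kn.
by rewrite /normsq /= expr0n /= addr0 !mulr0.
Qed.

Lemma det_exp_udiag d (U : 'M[C]_d) (x : 'rV[R]_d) : U \is unitarymx ->
  \det (udiag U (map_mx expR x)) = (expR (\sum_i x 0 i))%:C.
Proof.
move=> Uu; rewrite udiagE !det_mulmx mulrC mulrA -det_mulmx (unitarymxP Uu).
rewrite det1 mul1r det_diag expR_sum rmorph_prod; apply: eq_bigr => i _.
by rewrite !mxE.
Qed.

Lemma eigvals_exp_udiag d (U : 'M[C]_d) (x : 'rV[R]_d) : U \is unitarymx ->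
  nonincreasing_vec x -> eigvals (udiag U (map_mx expR x)) = map_mx expR x.
Proof.
move=> Uu xn; apply: eigvals_udiag => // i j ij.
by rewrite !mxE ler_expR xn.
Qed.

Lemma trace_udiagM d (U : 'M[C]_d) (x y : 'rV[R]_d) : U \is unitarymx ->
  \tr (udiag U x *m udiag U y) = (\sum_i x 0 i * y 0 i)%:C.
Proof.
move=> Uu; rewrite udiagM// udiagE mxtrace_mulC mulmxA (unitarymxP Uu) mul1mx.
by rewrite mxtrace_diag rmorph_sum; apply: eq_bigr => i _; rewrite !mxE.
Qed.

End Inequalities.

(** * First-order optimality conditions and majorization *)

Section Optimality.
Variable R : realType.
Local Notation C := R[i].

Lemma invmx_uniq d (A B : 'M[C]_d) : A *m B = 1%:M -> invmx A = B.
Proof.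
by move=> AB; have [Au _] := mulmx1_unit AB; rewrite -[RHS](mulKmx Au) AB mulmx1.
Qed.

(* Multiplying [X] by [exp] of [tau] times a rank [s] projector moves every
   eigenvalue of [log X] up by at most [tau], and their sum by [s tau]. *)
Lemma dotr_log_perturb d (a : 'rV[R]_d) (X X' E V : 'M[C]_d) s (tau : R) :
  nonincreasing_vec a -> X \is hermsymmx -> loewner_le 1%:M X ->
  V \is unitarymx -> (s <= d)%N -> 0 < tau ->
  let g := udiag V (map_mx expR (\row_i (if (i < s)%N then tau else 0))) in
  X = E *m E^t* -> X' = E *m g *m E^t* ->
  [/\ X' \is hermsymmx, loewner_le 1%:M X' &
      dotr a (eigvals (logmx X')) <= dotr a (eigvals (logmx X)) + tau * psum a s].
Proof.
move=> an Xh X1 Vu sd tau0 g XE X'E.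
have gh : g^t* = g by apply/hermsymmxP; exact: udiag_herm.
have X'h : X' \is hermsymmx.
  by apply/hermsymmxP; rewrite X'E 2!trmxC_mul trmxCK mulmxA gh.
have le1 : loewner_le X X'.
  rewrite /loewner_le XE X'E -[X in _ - X *m _]mulmx1 -mulmxBl -mulmxBr.
  apply: psdmx_congr.
  rewrite -(udiag1 Vu) -udiagB; apply/psd_udiag => // i; rewrite !mxE subr_ge0.
  by case: ifP => _; rewrite ?expR0// -expR0 ler_expR ltW.
have X'1 : loewner_le 1%:M X' by apply: loewner_le_trans le1.
split => //.
have [U [x [Uu xn x0 XU]]] := exp_udiag_of_loewner1 Xh X1.
have [U' [x' [U'u x'n x'0 X'U]]] := exp_udiag_of_loewner1 X'h X'1.
have XtE : (expR tau)%:C *: X = udiag U (map_mx expR (\row_i (tau + x 0 i))).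
  by rewrite XU -udiagZ; congr udiag; apply/rowP => i; rewrite !mxE expRD.
have eX : eigvals X = map_mx expR x by rewrite XU (eigvals_exp_udiag Uu xn).
have eX' : eigvals X' = map_mx expR x' by rewrite X'U (eigvals_exp_udiag U'u x'n).
have eXt : eigvals ((expR tau)%:C *: X) = map_mx expR (\row_i (tau + x 0 i)).
  rewrite XtE; apply: (eigvals_exp_udiag Uu) => j l jl.
  by rewrite !mxE lerD2l; exact: xn.
have le2 : loewner_le X' ((expR tau)%:C *: X).
  have -> : (expR tau)%:C *: X = E *m ((expR tau)%:C *: udiag V (const_mx 1)) *m E^t*.
    by rewrite udiag1// -scalemxAr -scalemxAl mulmx1 XE.
  rewrite /loewner_le X'E -mulmxBl -mulmxBr; apply: psdmx_congr.
  rewrite -udiagZ -udiagB; apply/psd_udiag => // i; rewrite !mxE subr_ge0 mulr1.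
  by case: ifP => _//; rewrite ler_expR ltW.
have x'x i : x 0 i <= x' 0 i <= tau + x 0 i.
  have := weyl_monotone Xh X'h le1 i.
  have Xth : (expR tau)%:C *: X \is hermsymmx by rewrite XtE udiag_herm.
  have := weyl_monotone X'h Xth le2 i.
  rewrite eX eX' eXt !mxE !ler_expR => h1 h2.
  by apply/andP; split; [exact: h2|exact: h1].
have sumE : \sum_i x' 0 i = \sum_i x 0 i + tau * s%:R.
  have : \det X' = \det X * \det g.
    by rewrite X'E XE !det_mulmx mulrAC.
  rewrite X'U XU /g (det_exp_udiag _ U'u) (det_exp_udiag _ Uu).
  rewrite (det_exp_udiag _ Vu) -rmorphM -expRD => /complexI/expR_inj->.
  congr (_ + _); rewrite -(sum_ltn_ord R sd) mulr_sumr; apply: eq_bigr => i _.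
  by rewrite mxE; case: ifP; rewrite ?mulr1 ?mulr0.
rewrite X'U XU (eigvals_logmx U'u x'n) (eigvals_logmx Uu xn) -lerBlDl.
(* The normalized increments lie in [[0, 1]] and sum to [s], so they form a point of the
   hypersimplex. *)
pose c := \row_i ((x' 0 i - x 0 i) / tau).
have := @hypersimplex_le_psum _ _ a c s an sd.
have -> : \sum_j c 0 j * a 0 j = (dotr a x' - dotr a x) / tau.
  rewrite /dotr -sumrB mulr_suml; apply: eq_bigr => i _; rewrite mxE.
  by rewrite -mulrBr mulrAC [(_ - _) * a _ _]mulrC.
rewrite ler_pdivrMr// mulrC; apply => [i|].
  rewrite mxE divr_ge0 ?(ltW tau0)//=; last by rewrite subr_ge0; case/andP: (x'x i).
  by rewrite ler_pdivrMr// mul1r lerBlDr; case/andP: (x'x i).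
under eq_bigr do rewrite mxE.
rewrite -mulr_suml sumrB sumE; field; exact: lt0r_neq0.
Qed.

(** A comparison of slopes at [tau = 0], done with one explicit [tau]. For [P >= 0], the bound
    [1 - expR (- tau) >= tau / (1 + tau)] gives [T <= P * (1 + tau)], which contradicts
    [tau * (P + 1) = T - P] and [tau > 0]. For [P < 0], [tau = 1] suffices. *)
Lemma le_of_exp_slope (T P : R) :
  (forall tau, 0 < tau -> (1 - expR (- tau)) * T <= tau * P) -> T <= P.
Proof.
move=> H; rewrite leNgt; apply/negP => PT.
have [P0|P0] := leP 0 P; last first.
  have := H 1 ltr01; have := expR_gt0 (- 1 : R).
  have : expR (- 1 : R) < 1 by rewrite expR_lt1; lra.
  by move: (expR (- 1)) => e; nra.
pose tau := (T - P) / (P + 1).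
have tau0 : 0 < tau by rewrite divr_gt0//; lra.
have tauP : tau * (P + 1) = T - P by rewrite /tau divfK// gt_eqF//; lra.
have := H _ tau0.
have := expR_ge1Dx tau; rewrite expRN => e1.
have : (expR tau)^-1 <= (1 + tau)^-1 by rewrite lef_pV2 ?posrE ?expR_gt0//; lra.
have : (1 + tau)^-1 * (1 + tau) = 1 by rewrite mulVf// gt_eqF//; lra.
move: ((expR tau)^-1) ((1 + tau)^-1) => e f fE ef hT.
have : (1 - f) * T <= tau * P.
  by apply: le_trans hT; rewrite ler_wpM2r//; lra.
have -> : 1 - f = f * tau by lra.
rewrite mulrAC [tau * _]mulrC ler_pM2r// => fT.
have : f * T * (1 + tau) <= P * (1 + tau) by rewrite ler_wpM2r//; lra.
by rewrite mulrAC fE mul1r; nra.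
Qed.

Fact le_sub_of_exchange (S1 S2 e e' t : R) :
  S1 + e <= S2 + e' -> e' <= e + t -> S1 - S2 <= t.
Proof. lra. Qed.

(** [V] diagonalizes the scaled marginal, with eigenvalues [mu]. The perturbation in the top [s]
    eigendirections decreases the trace term by exactly [(1 - expR (- tau)) * psum mu s] and raises
    the logarithmic term by at most [tau * psum a s]. The lemma serves for [X] and for [Y], the
    other variables being fixed. *)
Lemma optimal_majorized d (N X D : 'M[C]_d) (a : 'rV[R]_d) :
  nonincreasing_vec a -> N \is hermsymmx ->
  X \is hermsymmx -> loewner_le 1%:M X ->
  D \in unitmx -> D^t* *m D = invmx X ->
  (forall X', X' \is hermsymmx -> loewner_le 1%:M X' ->
     complex.Re (\tr (N *m invmx X)) + dotr a (eigvals (logmx X)) <=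
     complex.Re (\tr (N *m invmx X')) + dotr a (eigvals (logmx X'))) ->
  weakly_majorized (eigvals (D *m N *m D^t*)) a.
Proof.
move=> an Nh Xh X1 Du DX opt.
have Mh : D *m N *m D^t* \is hermsymmx.
  by apply/hermsymmxP; rewrite !trmxC_mul trmxCK (hermsymmxP _ Nh) mulmxA.
have [V Vu ME] := spectral_sorted Mh.
apply/weakly_majorized_psum => //; first exact: eigvals_noninc.
move: (eigvals _) ME => mu ME s sd; apply: le_of_exp_slope => tau tau0.
pose E := invmx D.
have EDt : E^t* *m D^t* = 1%:M by rewrite -trmxC_mul (mulmxV Du) trmxC1.
have DEt : D^t* *m E^t* = 1%:M by rewrite -trmxC_mul (mulVmx Du) trmxC1.
have XE : X = E *m E^t*.
  rewrite -[X]invmxK -DX; apply: invmx_uniq.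
  rewrite -mulmxA [D *m _]mulmxA (mulmxV Du) mul1mx; exact: DEt.
pose gamma : 'rV[R]_d := \row_i (if (i < s)%N then tau else 0).
have [X' X'E] : exists X', X' = E *m udiag V (map_mx expR gamma) *m E^t*.
  by eexists.
have [X'h X'1] := @dotr_log_perturb _ a X X' E V s tau an Xh X1 Vu sd tau0 XE X'E.
have X'inv : invmx X' = D^t* *m udiag V (map_mx expR (- gamma)) *m D.
  apply: invmx_uniq; rewrite X'E.
  have : udiag V (map_mx expR gamma) *m udiag V (map_mx expR (- gamma)) = 1%:M.
    rewrite (udiagM _ _ Vu) -(udiag1 Vu); congr udiag.
    by apply/rowP => i; rewrite !mxE -expRD subrr expR0.
  move: (udiag V _) (udiag V _) => G' G GG'.
  rewrite -!mulmxA [E^t* *m _]mulmxA EDt mul1mx [G *m _]mulmxA GG' mul1mx.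
  exact: mulVmx.
have trE (f : 'rV[R]_d) : complex.Re (\tr (N *m (D^t* *m udiag V f *m D)))
    = \sum_i mu 0 i * f 0 i.
  rewrite [\tr _](_ : _ = \tr (D *m N *m D^t* *m udiag V f)).
    by rewrite ME (trace_udiagM _ _ Vu).
  by move: (udiag V f) => G; rewrite mulmxA mxtrace_mulC !mulmxA.
have Xinv : invmx X = D^t* *m udiag V (const_mx 1) *m D.
  by rewrite (udiag1 Vu) mulmx1 DX.
have t1 := trE (const_mx 1); rewrite -Xinv in t1.
have t2 := trE (map_mx expR (- gamma)); rewrite -X'inv in t2.
have := opt _ X'h X'1; rewrite t1 t2 => h1 h2.
have -> : (1 - expR (- tau)) * psum mu s = \sum_i mu 0 i * (const_mx 1 : 'rV_d) 0 i -
   \sum_i mu 0 i * (map_mx expR (- gamma)) 0 i.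
  rewrite -sumrB /psum big_mkcond mulr_sumr; apply: eq_bigr => i _.
  rewrite !mxE; case: ifP => _; first by ring.
  by rewrite oppr0 expR0 subrr mulr0.
exact: le_sub_of_exchange h1 h2.
Qed.
End Optimality.

(** * Completely positive maps in adapted bases *)

Section CPMaps.
Variable R : realType.
Local Notation C := R[i].
Variables m n p : nat.
Implicit Types (A K : 'I_p -> 'M[C]_(m, n)) (U W D : 'M[C]_n) (V Z B : 'M[C]_m).

Definition weight A U V (j : 'I_m) (i : 'I_n) : R :=
  \sum_l normsq (cp_scaling V U A l j i).

Lemma weight_ge0 A U V j i : 0 <= weight A U V j i.
Proof. by apply: sumr_ge0 => l _; exact: normsq_ge0. Qed.

Lemma mxtrace_sum (I : finType) d (F : I -> 'M[C]_d) :
  \tr (\sum_i F i) = \sum_i \tr (F i).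
Proof. exact: raddf_sum. Qed.

Lemma mul_diag_adjE (M : 'M[C]_(m, n)) (f : 'rV[R]_n) j :
  (M *m diag_mx (map_mx (real_complex R) f) *m M^t*) j j =
  (\sum_i f 0 i * normsq (M j i))%:C.
Proof.
rewrite mul_mx_diag mxE rmorph_sum; apply: eq_bigr => i _.
by rewrite !mxE rmorphM/= normsqE mulrAC mulrC.
Qed.

Lemma trace_cp_udiag A U V (f : 'rV[R]_n) (g : 'rV[R]_m) :
  complex.Re (\tr (cp_map A (udiag U f) *m udiag V g)) =
  \sum_j \sum_i weight A U V j i * f 0 i * g 0 j.
Proof.
have -> : \tr (cp_map A (udiag U f) *m udiag V g) =
    (\sum_l \sum_j \sum_i f 0 i * normsq (cp_scaling V U A l j i) * g 0 j)%:C.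
  rewrite /cp_map mulmx_suml mxtrace_sum rmorph_sum.
  apply: eq_bigr => l _; set M := cp_scaling V U A l.
  transitivity (\tr (M *m diag_mx (map_mx (real_complex R) f) *m M^t*
           *m diag_mx (map_mx (real_complex R) g))).
    rewrite /M /cp_scaling !udiagE !trmxC_mul trmxCK !mulmxA [LHS]mxtrace_mulC.
    by rewrite !mulmxA.
  rewrite mul_mx_diag /mxtrace rmorph_sum; apply: eq_bigr => j _.
  rewrite mxE mul_diag_adjE mxE -rmorphM; congr (_%:C).
  by rewrite mulr_suml.
rewrite Re_real_complex exchange_big; apply: eq_bigr => j _ /=.
rewrite exchange_big; apply: eq_bigr => i _ /=; rewrite /weight -!mulr_suml.
by congr (_ * _); rewrite mulr_suml; apply: eq_bigr => l _; rewrite mulrC.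
Qed.

Lemma trace_cp_adjoint A (X : 'M[C]_n) (Y : 'M[C]_m) :
  \tr (cp_map A X *m Y) = \tr (cp_adjoint A Y *m X).
Proof.
rewrite /cp_map /cp_adjoint !mulmx_suml !mxtrace_sum.
apply: eq_bigr => l _; rewrite -!mulmxA mxtrace_mulC -!mulmxA.
by rewrite mxtrace_mulC -!mulmxA.
Qed.

Lemma cp_map_scaling A B D :
  cp_map (cp_scaling B D A) 1%:M = B *m cp_map A (D^t* *m D) *m B^t*.
Proof.
rewrite /cp_map mulmx_sumr mulmx_suml; apply: eq_bigr => l _.
by rewrite /cp_scaling !trmxC_mul trmxCK mulmx1 !mulmxA.
Qed.

Lemma cp_adjoint_scaling A B D :
  cp_adjoint (cp_scaling B D A) 1%:M = D *m cp_adjoint A (B^t* *m B) *m D^t*.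
Proof.
rewrite /cp_adjoint mulmx_sumr mulmx_suml; apply: eq_bigr => l _.
by rewrite /cp_scaling !trmxC_mul trmxCK mulmx1 !mulmxA.
Qed.

Lemma cp_map_herm A X : X \is hermsymmx -> cp_map A X \is hermsymmx.
Proof.
move=> /hermsymmxP Xh; apply/hermsymmxP; rewrite trmxC_sum.
by apply: eq_bigr => l _; rewrite !trmxC_mul trmxCK Xh mulmxA.
Qed.

Lemma cp_adjoint_herm A Y : Y \is hermsymmx -> cp_adjoint A Y \is hermsymmx.
Proof.
move=> /hermsymmxP Yh; apply/hermsymmxP; rewrite trmxC_sum.
by apply: eq_bigr => l _; rewrite !trmxC_mul trmxCK Yh mulmxA.
Qed.

Lemma herm1 d : (1%:M : 'M[C]_d) \is hermsymmx.
Proof. by apply/hermsymmxP; rewrite trmxC1. Qed.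

Lemma cp_map1_diag K j :
  complex.Re (cp_map K 1%:M j j) = \sum_l \sum_i normsq (K l j i).
Proof.
have -> : cp_map K 1%:M j j = (\sum_l \sum_i normsq (K l j i))%:C; last by [].
rewrite /cp_map summxE rmorph_sum; apply: eq_bigr => l _.
rewrite mulmx1 mxE rmorph_sum/=; apply: eq_bigr => i _.
by rewrite !mxE normsqE.
Qed.

Lemma cp_adjoint1_diag K i :
  complex.Re (cp_adjoint K 1%:M i i) = \sum_l \sum_j normsq (K l j i).
Proof.
have -> : cp_adjoint K 1%:M i i = (\sum_l \sum_j normsq (K l j i))%:C; last by [].
rewrite /cp_adjoint summxE rmorph_sum; apply: eq_bigr => l _.
rewrite mulmx1 mxE rmorph_sum/=; apply: eq_bigr => j _.
by rewrite !mxE normsqE mulrC.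
Qed.

Lemma ReD (x y : C) : complex.Re (x + y) = complex.Re x + complex.Re y.
Proof. by case: x; case: y. Qed.

Lemma Re_sum (I : finType) (F : I -> C) :
  complex.Re (\sum_i F i) = \sum_i complex.Re (F i).
Proof. by apply: (big_morph (@complex.Re R) ReD). Qed.

Lemma cp_sizeE K : cp_size K = \sum_j \sum_l \sum_i normsq (K l j i).
Proof.
by rewrite /cp_size /mxtrace Re_sum; apply: eq_bigr => j _; exact: cp_map1_diag.
Qed.

Lemma cp_size_unitary K Z W : Z \is unitarymx -> W \is unitarymx ->
  cp_size (cp_scaling Z W K) = cp_size K.
Proof.
move=> Zu Wu; rewrite /cp_size cp_map_scaling unitarymx_mulVmx//.
by rewrite mxtrace_mulC mulmxA unitarymx_mulVmx// mul1mx.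
Qed.

Lemma cp_scaling_comp A U V B D Z W l : U \is unitarymx -> V \is unitarymx ->
  cp_scaling Z W (cp_scaling B D A) l =
  (Z *m (B *m V^t*)) *m cp_scaling V U A l *m (W *m (D *m U^t*))^t*.
Proof.
move=> /unitarymx_mulVmx UU /unitarymx_mulVmx VV.
rewrite /cp_scaling !trmxC_mul trmxCK !mulmxA.
rewrite -(mulmxA _ (V^t*) V) VV mulmx1 -(mulmxA _ (U^t*) U) UU mulmx1.
by [].
Qed.

(* Upper triangularizing [B V^t*] and [D U^t*] by unitaries moves the zero
   block of [V A U^t*] to the scaled map without changing its spectra. *)
Lemma zero_block_size A U V B D c d (K := cp_scaling B D A) :
  U \is unitarymx -> V \is unitarymx ->
  (c <= n)%N -> (d <= m)%N ->
  (forall l (j : 'I_m) (i : 'I_n), (d <= j)%N -> (c <= i)%N ->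
     cp_scaling V U A l j i = 0) ->
  cp_size K <= psum (eigvals (cp_adjoint K 1%:M)) c
             + psum (eigvals (cp_map K 1%:M)) d.
Proof.
move=> Uu Vu cn dm A0.
have [Z Zu ZT] := unitary_triangularization (B *m V^t*).
have [W Wu WT] := unitary_triangularization (D *m U^t*).
pose K' := cp_scaling Z W K.
have K'0 l (j : 'I_m) (i : 'I_n) : (d <= j)%N -> (c <= i)%N -> K' l j i = 0.
  move=> dj ci.
  have -> : K' l = (Z *m (B *m V^t*)) *m cp_scaling V U A l *m (W *m (D *m U^t*))^t*.
    exact: cp_scaling_comp.
  (* Triangularity leaves only the terms with [i' >= i] and [j' >= j], and these stay inside the
     zero block. *)
  rewrite mxE big1// => i' _; rewrite [_^t* _ _]mxE [_^T _ _]mxE.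
  have [i'i|ii'] := ltnP i' i; first by rewrite WT// conjC0 mulr0.
  rewrite mxE big1 ?mul0r// => j' _.
  have [j'j|jj'] := ltnP j' j; first by rewrite ZT// mul0r.
  by rewrite A0 ?mulr0// (leq_trans _ jj', leq_trans _ ii').
rewrite -(cp_size_unitary K Zu Wu) -/K' cp_sizeE.
have := ky_fan (cp_adjoint_herm K (herm1 _)) Wu cn.
have <- : cp_adjoint K' 1%:M = W *m cp_adjoint K 1%:M *m W^t*.
  by rewrite /K' cp_adjoint_scaling unitarymx_mulVmx.
have := ky_fan (cp_map_herm K (herm1 _)) Zu dm.
have <- : cp_map K' 1%:M = Z *m cp_map K 1%:M *m Z^t*.
  by rewrite /K' cp_map_scaling unitarymx_mulVmx.
under eq_bigr do rewrite cp_map1_diag.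
move=> h1.
under eq_bigr do rewrite cp_adjoint1_diag.
move=> h2; apply: le_trans (lerD h2 h1).
(* Each nonzero entry lies in a column before [c] or in a row before [d]. The first Ky Fan sum
   counts the former, the second the latter. *)
rewrite [X in X + _](_ : _ = \sum_j \sum_l \sum_(i < n | (i < c)%N) normsq (K' l j i)).
  rewrite [X in _ + X]big_mkcond -big_split/= ler_sum// => j _.
  case: ltnP => dj.
    rewrite lerDr sumr_ge0// => l _; rewrite sumr_ge0// => i _; exact: normsq_ge0.
  rewrite addr0 ler_sum// => l _; rewrite [leRHS]big_mkcond ler_sum// => i _.
  by case: ltnP => ci //; rewrite K'0// /normsq /= expr0n /= addr0.
rewrite exchange_big/= [RHS]exchange_big; apply: eq_bigr => l _ /=.
by rewrite exchange_big.
Qed.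

Lemma cap_objE k A alpha beta U V (x : 'rV[R]_n) (y : 'rV[R]_m) z :
  U \is unitarymx -> V \is unitarymx ->
  nonincreasing_vec x -> nonincreasing_vec y ->
  cap_obj k A alpha beta
    (udiag U (map_mx expR x), udiag V (map_mx expR y), z) =
  \sum_j \sum_i weight A U V j i * expR (z - x 0 i - y 0 j)
  + dotr alpha x + dotr beta y - k * z.
Proof.
move=> Uu Vu xn yn; rewrite /cap_obj !eigvals_logmx//; congr (_ + _ + _ - _).
rewrite !udiag_inv//; last 2 first.
- by move=> i; rewrite mxE gt_eqF ?expR_gt0.
- by move=> i; rewrite mxE gt_eqF ?expR_gt0.
rewrite trace_cp_udiag mulr_suml; apply: eq_bigr => j _.
rewrite mulr_suml; apply: eq_bigr => i _.
by rewrite !mxE -!expRN -!mulrA -!expRD; congr (_ * expR _); ring.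
Qed.

Lemma cap_domain_udiag U V (x : 'rV[R]_n) (y : 'rV[R]_m) z :
  U \is unitarymx -> V \is unitarymx ->
  (forall i, 0 <= x 0 i) -> (forall j, 0 <= y 0 j) -> 0 <= z ->
  @cap_domain R m n (udiag U (map_mx expR x), udiag V (map_mx expR y), z).
Proof.
by move=> Uu Vu x0 y0 z0; split => //=; rewrite ?udiag_herm//;
  exact: loewner1_exp_udiag.
Qed.

Lemma cap_domainP q : @cap_domain R m n q -> exists U V x y z,
  [/\ U \is unitarymx, V \is unitarymx, nonincreasing_vec x, nonincreasing_vec y &
  [/\ forall i, 0 <= x 0 i, forall j, 0 <= y 0 j, 0 <= z &
      q = (udiag U (map_mx expR x), udiag V (map_mx expR y), z)]].
Proof.
case: q => -[X Y] z [/= Xh Yh X1 Y1 z0].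
have [U [x [Uu xn x0 ->]]] := exp_udiag_of_loewner1 Xh X1.
have [V [y [Vu yn y0 ->]]] := exp_udiag_of_loewner1 Yh Y1.
by exists U, V, x, y, z.
Qed.

End CPMaps.

(** * Minima over unitary bases and bounded spectra *)

Section Compactness.
Variable R : realType.
Local Notation C := R[i].
Local Open Scope classical_set_scope.

(** * Continuity of matrix entries and closed conditions *)

Section ContinuousMatrices.
Variable T : topologicalType.
Implicit Types (g h : T -> R) (u v : T -> C).

Lemma continuous_addf g h : continuous g -> continuous h ->
  continuous (fun t => g t + h t).
Proof. by move=> gc hc t; apply: (@continuousD _ _ _ g h); [exact: gc|exact: hc]. Qed.

Lemma continuous_oppf g : continuous g -> continuous (fun t => - g t).
Proof. by move=> gc t; apply: (@continuousN _ _ _ g); exact: gc. Qed.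

Lemma continuous_mulf g h : continuous g -> continuous h ->
  continuous (fun t => g t * h t).
Proof. by move=> gc hc t; apply: (@continuousM _ _ g h); [exact: gc|exact: hc]. Qed.

Lemma continuous_constf (c : R) : continuous (fun _ : T => c).
Proof. by move=> t; exact: cst_continuous. Qed.

Lemma continuous_sumf (I : Type) (r : seq I) (P : pred I) (F : I -> T -> R) :
  (forall i, continuous (F i)) ->
  continuous (fun t => \sum_(i <- r | P i) F i t).
Proof.
move=> Fc; elim: r => [|i r IH].
  by under eq_fun do rewrite big_nil; exact: continuous_constf.
under eq_fun do rewrite big_cons; case: (P i) => //.
exact: continuous_addf.
Qed.

Lemma continuous_expf g : continuous g -> continuous (fun t => expR (g t)).
Proof.
move=> gc t; apply: (@continuous_comp _ _ _ g expR); first exact: gc.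
exact: continuous_expR.
Qed.

(** Real and imaginary parts are treated separately, so that only the topology of [R] is
    involved. *)
Definition ccontinuous u :=
  continuous (fun t => complex.Re (u t)) /\ continuous (fun t => complex.Im (u t)).

Lemma ccontinuousM u v : ccontinuous u -> ccontinuous v ->
  ccontinuous (fun t => u t * v t).
Proof.
move=> [ur ui] [vr vi]; split.
  rewrite (_ : (fun t => _) = (fun t => complex.Re (u t) * complex.Re (v t)
      + - (complex.Im (u t) * complex.Im (v t)))).
    by apply: continuous_addf; [|apply: continuous_oppf]; exact: continuous_mulf.
  by apply/funext => t; case: (u t) => a b; case: (v t).
rewrite (_ : (fun t => _) = (fun t => complex.Re (u t) * complex.Im (v t)
    + complex.Im (u t) * complex.Re (v t))).
  by apply: continuous_addf; exact: continuous_mulf.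
by apply/funext => t; case: (u t) => a b; case: (v t).
Qed.

Lemma ccontinuousJ u : ccontinuous u -> ccontinuous (fun t => (u t)^*).
Proof.
move=> [ur ui]; split.
  rewrite (_ : (fun t => _) = (fun t => complex.Re (u t)))//.
  by apply/funext => t; case: (u t).
rewrite (_ : (fun t => _) = (fun t => - complex.Im (u t))).
  exact: continuous_oppf.
by apply/funext => t; case: (u t).
Qed.

Lemma ccontinuous_sum (I : finType) (F : I -> T -> C) :
  (forall i, ccontinuous (F i)) -> ccontinuous (fun t => \sum_i F i t).
Proof.
move=> Fc; split.
  under eq_fun do rewrite (big_morph (@complex.Re R) (@ReD R) erefl).
  by apply: continuous_sumf => i; have [] := Fc i.
have ImD (x y : C) : complex.Im (x + y) = complex.Im x + complex.Im y.
  by case: x; case: y.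
under eq_fun do rewrite (big_morph (@complex.Im R) ImD erefl).
by apply: continuous_sumf => i; have [] := Fc i.
Qed.

Definition mcontinuous a b (M : T -> 'M[C]_(a, b)) :=
  forall i j, ccontinuous (fun t => M t i j).

Lemma mcontinuous_const a b (M : 'M[C]_(a, b)) : mcontinuous (fun=> M).
Proof. by move=> i j; split; exact: continuous_constf. Qed.

Lemma mcontinuousM a b c (M : T -> 'M[C]_(a, b)) (N : T -> 'M[C]_(b, c)) :
  mcontinuous M -> mcontinuous N -> mcontinuous (fun t => M t *m N t).
Proof.
move=> Mc Nc i j; under eq_fun do rewrite mxE.
by apply: ccontinuous_sum => l; apply: ccontinuousM.
Qed.

Lemma mcontinuous_adj a b (M : T -> 'M[C]_(a, b)) :
  mcontinuous M -> mcontinuous (fun t => (M t)^t*).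
Proof. by move=> Mc i j; under eq_fun do rewrite !mxE; exact: ccontinuousJ. Qed.

Lemma continuous_weight m n p (A : 'I_p -> 'M[C]_(m, n)) U V j i :
  mcontinuous U -> mcontinuous V ->
  continuous (fun t => weight A (U t) (V t) j i).
Proof.
move=> Uc Vc; apply: continuous_sumf => l.
have : mcontinuous (fun t => cp_scaling (V t) (U t) A l).
  apply: mcontinuousM; last exact: mcontinuous_adj.
  by apply: mcontinuousM => //; exact: mcontinuous_const.
move=> /(_ j i)[rc ic]; apply: continuous_addf.
  by apply: (@continuous_mulf (fun t => complex.Re _) (fun t => complex.Re _)).
by apply: (@continuous_mulf (fun t => complex.Im _) (fun t => complex.Im _)).
Qed.

Lemma closed_forall (I : Type) (F : I -> set T) : (forall i, closed (F i)) ->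
  closed [set t | forall i, F i t].
Proof.
move=> Fc; rewrite (_ : mkset _ = \bigcap_i F i).
  exact: closed_bigI.
by apply/seteqP; split => [t Ft i _|t Ft i]; exact: Ft.
Qed.

Lemma closed_eqf g (c : R) : continuous g -> closed [set t | g t = c].
Proof.
move=> gc; apply: (@preimage_closed _ _ g [set r | r = c]); last exact: closed_eq.
by move=> t _; exact: gc.
Qed.

Lemma closed_lef g h : continuous g -> continuous h -> closed [set t | g t <= h t].
Proof.
move=> gc hc.
rewrite (_ : mkset _ = (fun t => h t + - g t) @^-1` [set r | 0 <= r]).
  apply: preimage_closed; last exact: closed_ge.
  by move=> t _; apply: continuous_addf => //; exact: continuous_oppf.
by apply/seteqP; split => t /=; rewrite subr_ge0.
Qed.

Lemma closed_unitary a (M : T -> 'M[C]_a) : mcontinuous M ->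
  closed [set t | M t \is unitarymx].
Proof.
move=> Mc; have MMc := mcontinuousM Mc (mcontinuous_adj Mc).
rewrite (_ : mkset _ = [set t | forall ij : 'I_a * 'I_a,
    ([set t | complex.Re ((M t *m (M t)^t*) ij.1 ij.2) = (ij.1 == ij.2)%:R] `&`
     [set t | complex.Im ((M t *m (M t)^t*) ij.1 ij.2) = 0]) t]).
  apply: closed_forall => -[i j] /=; have [rc ic] := MMc i j.
  by apply: closedI; exact: closed_eqf.
have delta (i j : 'I_a) : (1%:M : 'M[C]_a) i j = ((i == j)%:R : R)%:C.
  by rewrite mxE; case: (i == j).
apply/seteqP; split => t /=.
  by move=> /unitarymxP -> [i j] /=; rewrite delta.
move=> h; apply/unitarymxP/matrixP => i j; rewrite delta.
have [/= hr hi] := h (i, j); move: hr hi.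
by case: (_ i j) => x y /= -> ->.
Qed.

Lemma closed_noninc a (x : T -> 'rV[R]_a) : (forall i, continuous (fun t => x t 0 i)) ->
  closed [set t | nonincreasing_vec (x t)].
Proof.
move=> xc; apply: closed_forall => i; apply: closed_forall => j.
apply: closed_forall => ij; exact: closed_lef.
Qed.

End ContinuousMatrices.

(** * Compact boxes of bases and spectra *)

Section ParameterBox.
Variables m n : nat.
(** One real coordinate per index: the boolean selects the imaginary part of an entry of [U] or [V],
    and the last summand indexes [x], [y] and [z]. The product form makes Tychonoff's theorem
    available. *)
Let J : eqType :=
  (('I_n * 'I_n * bool) + ('I_m * 'I_m * bool) + ('I_n + 'I_m + unit))%type.
Definition params : topologicalType :=
  prod_topology (fun _ : J => R : topologicalType).
Implicit Type w : params.

Definition param_U w : 'M[C]_n :=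
  \matrix_(i, j) (w (inl (inl (i, j, false))) +i* w (inl (inl (i, j, true)))).
Definition param_V w : 'M[C]_m :=
  \matrix_(i, j) (w (inl (inr (i, j, false))) +i* w (inl (inr (i, j, true)))).
Definition param_x w : 'rV[R]_n := \row_i w (inr (inl (inl i))).
Definition param_y w : 'rV[R]_m := \row_i w (inr (inl (inr i))).
Definition param_z w : R := w (inr (inr tt)).

Lemma continuous_coord (j : J) : continuous (fun w : params => w j).
Proof. exact: (@proj_continuous J (fun=> R) j). Qed.

Lemma mcontinuous_U : mcontinuous param_U.
Proof.
by move=> i j; split; under eq_fun do rewrite mxE /=; exact: continuous_coord.
Qed.

Lemma mcontinuous_V : mcontinuous param_V.
Proof.
by move=> i j; split; under eq_fun do rewrite mxE /=; exact: continuous_coord.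
Qed.

Lemma continuous_x i : continuous (fun w => param_x w 0 i).
Proof. by under eq_fun do rewrite mxE /=; exact: continuous_coord. Qed.

Lemma continuous_y i : continuous (fun w => param_y w 0 i).
Proof. by under eq_fun do rewrite mxE /=; exact: continuous_coord. Qed.

Definition param_box (b : R) (U : 'M[C]_n) (V : 'M[C]_m) (x : 'rV[R]_n)
    (y : 'rV[R]_m) (z : R) : Prop :=
  [/\ U \is unitarymx, V \is unitarymx, nonincreasing_vec x, nonincreasing_vec y &
  [/\ forall i, 0 <= x 0 i <= b, forall j, 0 <= y 0 j <= b & 0 <= z <= b]].

Lemma unitary_entry_bound d (U : 'M[C]_d) i j : U \is unitarymx ->
  -1 <= complex.Re (U i j) <= 1 /\ -1 <= complex.Im (U i j) <= 1.
Proof.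
move=> Uu; have : normsq (U i j) <= 1.
  rewrite -(sum_normsq_row i Uu) (bigD1 j)//= lerDl.
  by apply: sumr_ge0 => *; exact: normsq_ge0.
rewrite /normsq; case: (U i j) => a b /= h; split; nra.
Qed.

Lemma unitary1 d : (1%:M : 'M[C]_d) \is unitarymx.
Proof. by apply/unitarymxP; rewrite trmxC1 mulmx1. Qed.

(** Entries of unitary matrices have real and imaginary parts in [[-1, 1]], so the box is cut out of
    a product of segments by closed conditions. *)
Lemma param_box_min (b : R)
    (f : 'M[C]_n -> 'M[C]_m -> 'rV[R]_n -> 'rV[R]_m -> R -> R) :
  0 <= b ->
  continuous (fun w => f (param_U w) (param_V w) (param_x w) (param_y w) (param_z w)) ->
  exists U V x y z, param_box b U V x y z /\
    forall U' V' x' y' z', param_box b U' V' x' y' z' ->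
      f U V x y z <= f U' V' x' y' z'.
Proof.
move=> b0 fc.
pose B (j : J) : set R :=
  if j is inl _ then `[-1, 1]%classic else `[0, b]%classic.
pose K : set params := [set w | forall j, B j (w j)] `&`
  ([set w | param_U w \is unitarymx] `&` [set w | param_V w \is unitarymx] `&`
   ([set w | nonincreasing_vec (param_x w)] `&`
    [set w | nonincreasing_vec (param_y w)])).
have Kc : compact K.
  apply: compact_closedI.
    by apply: (@tychonoff J (fun=> R) B) => -[j|j]; exact: segment_compact.
  apply: closedI; apply: closedI.
  - by apply: closed_unitary; exact: mcontinuous_U.
  - by apply: closed_unitary; exact: mcontinuous_V.
  - by apply: closed_noninc; exact: continuous_x.
  - by apply: closed_noninc; exact: continuous_y.
have surj U V x y z : param_box b U V x y z -> exists w, [/\ K w, param_U w = U,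
    param_V w = V, param_x w = x & (param_y w = y) /\ (param_z w = z)].
  move=> [Uu Vu xn yn [xb yb zb]].
  pose w : params := fun j => match j with
    | inl (inl (i, j, c)) => if c then complex.Im (U i j) else complex.Re (U i j)
    | inl (inr (i, j, c)) => if c then complex.Im (V i j) else complex.Re (V i j)
    | inr (inl (inl i)) => x 0 i
    | inr (inl (inr j)) => y 0 j
    | inr (inr _) => z
    end.
  have wU : param_U w = U by apply/matrixP => i j; rewrite mxE /=; case: (U i j).
  have wV : param_V w = V by apply/matrixP => i j; rewrite mxE /=; case: (V i j).
  have wx : param_x w = x by apply/rowP => i; rewrite mxE.
  have wy : param_y w = y by apply/rowP => i; rewrite mxE.
  exists w; split; [split|exact: wU|exact: wV|exact: wx|by split; first exact: wy]; last first.
    by rewrite /= wU wV wx wy.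
  move=> [[[[i j] c]|[[i j] c]]|[[i|j]|[]]] /=; rewrite in_itv/= //.
    by have [] := unitary_entry_bound i j Uu; case: c.
  by have [] := unitary_entry_bound i j Vu; case: c.
have Kbox w : K w ->
    param_box b (param_U w) (param_V w) (param_x w) (param_y w) (param_z w).
  move=> [wB [[Uu Vu] [xn yn]]]; split => //; split => [i|j|].
  - by have := wB (inr (inl (inl i))); rewrite /= in_itv/= mxE.
  - by have := wB (inr (inl (inr j))); rewrite /= in_itv/= mxE.
  - by have := wB (inr (inr tt)); rewrite /= in_itv/=.
have K0 : K !=set0.
  have [|w [Kw _ _ _ _]] := @surj 1%:M 1%:M 0 0 0; last by exists w.
  split; rewrite ?unitary1//; last by split; rewrite ?lexx//= => i; rewrite mxE lexx.
    by move=> i j _; rewrite !mxE.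
  by move=> i j _; rewrite !mxE.
have [w /set_mem Kw wmin] := compact_EVT_min K0 Kc (continuous_subspaceT fc).
exists (param_U w), (param_V w), (param_x w), (param_y w), (param_z w).
split; first exact: Kbox.
move=> U V x y z /surj[w' [Kw' <- <- <- [<- <-]]].
by apply: wmin; exact: mem_set.
Qed.

End ParameterBox.
End Compactness.

(** * Scalability bounds the capacity *)

Section ScalableBounded.
Variable R : realType.
Local Notation C := R[i].
Variables m n p : nat.
Implicit Types (A : 'I_p -> 'M[C]_(m, n)).

(** Ky Fan's inequality in the standard basis suffices, since the diagonal entries are sums of
    squared moduli. *)
Lemma psum_eigvals_adjoint_ge0 A s : (s <= n)%N ->
  0 <= psum (eigvals (cp_adjoint A 1%:M)) s.
Proof.
move=> sn; apply: le_trans (ky_fan (cp_adjoint_herm A (herm1 _ _)) (unitary1 _ _) sn).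
apply: sumr_ge0 => i _; rewrite trmxC1 mul1mx mulmx1 cp_adjoint1_diag.
by apply: sumr_ge0 => l _; apply: sumr_ge0 => j _; exact: normsq_ge0.
Qed.

Lemma psum_eigvals_map_ge0 A s : (s <= m)%N ->
  0 <= psum (eigvals (cp_map A 1%:M)) s.
Proof.
move=> sm; apply: le_trans (ky_fan (cp_map_herm A (herm1 _ _)) (unitary1 _ _) sm).
apply: sumr_ge0 => i _; rewrite trmxC1 mul1mx mulmx1 cp_map1_diag.
by apply: sumr_ge0 => l _; apply: sumr_ge0 => j _; exact: normsq_ge0.
Qed.

Variables (A : 'I_p -> 'M[C]_(m, n)) (alpha : 'rV[R]_n) (beta : 'rV[R]_m) (k : R).
Hypothesis alpha_noninc : nonincreasing_vec alpha.
Hypothesis beta_noninc : nonincreasing_vec beta.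

Lemma majorized_psum K : majorized_by K alpha beta ->
  (forall s, (s <= n)%N ->
     psum (eigvals (@cp_adjoint R m n p K 1%:M)) s <= psum alpha s) /\
  (forall s, (s <= m)%N -> psum (eigvals (cp_map K 1%:M)) s <= psum beta s).
Proof.
move=> [h1 h2]; split.
  by apply/weakly_majorized_psum => //; exact: eigvals_noninc.
by apply/weakly_majorized_psum => //; exact: eigvals_noninc.
Qed.

Lemma scalable_psum_ge0 : cp_scalable k A alpha beta ->
  (forall s, (s <= n)%N -> 0 <= psum alpha s) /\
  (forall s, (s <= m)%N -> 0 <= psum beta s).
Proof.
move=> /(_ 1 ltr01)[B [D [_ _ /majorized_psum[h1 h2] _]]]; split => s sd.
  by apply: le_trans (h1 s sd); exact: psum_eigvals_adjoint_ge0.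
by apply: le_trans (h2 s sd); exact: psum_eigvals_map_ge0.
Qed.

Lemma scalable_zero_block U V c d : cp_scalable k A alpha beta ->
  U \is unitarymx -> V \is unitarymx -> (c <= n)%N -> (d <= m)%N ->
  (forall l (j : 'I_m) (i : 'I_n), (d <= j)%N -> (c <= i)%N ->
     cp_scaling V U A l j i = 0) ->
  k <= psum alpha c + psum beta d.
Proof.
move=> sc Uu Vu cn dm A0; apply/ler_addgt0Pr => e e0.
have [B [D [_ _ /majorized_psum[h1 h2] hs]]] := sc _ e0.
rewrite -lerBlDr; apply: le_trans hs _.
apply: le_trans (zero_block_size B D Uu Vu cn dm A0) _.
by apply: lerD; [exact: h1|exact: h2].
Qed.

Lemma finite_common_gt0 (I : finType) (Q : I -> R -> Prop) :
  (forall i a b, b <= a -> Q i a -> Q i b) ->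
  (forall i, exists2 a, 0 < a & Q i a) ->
  exists2 a, 0 < a & forall i, Q i a.
Proof.
move=> Qle Qex.
suff H (s : seq I) : exists2 a, 0 < a & forall i, i \in s -> Q i a.
  by have [a a0 aQ] := H (enum I); exists a => // i; apply: aQ; rewrite mem_enum.
elim: s => [|i s [a a0 aQ]]; first by exists 1.
have [b b0 bQ] := Qex i; exists (Num.min a b); first by rewrite lt_min a0.
move=> j; rewrite inE => /orP[/eqP->|/aQ].
  by apply: Qle bQ; rewrite ge_min lexx orbT.
by apply: Qle; rewrite ge_min lexx.
Qed.

Lemma block_weight_gap : cp_scalable k A alpha beta ->
  exists2 delta, 0 < delta & forall c d, (c <= n)%N -> (d <= m)%N ->
    k <= psum alpha c + psum beta d \/
    forall U V, U \is unitarymx -> V \is unitarymx ->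
      delta <= \sum_(j < m | (d <= j)%N) \sum_(i < n | (c <= i)%N) weight A U V j i.
Proof.
move=> sc; pose bs c d U V : R :=
  \sum_(j < m | (d <= j)%N) \sum_(i < n | (c <= i)%N) weight A U V j i.
have bs_ge0 c d U V : 0 <= bs c d U V.
  by apply: sumr_ge0 => j _; apply: sumr_ge0 => i _; exact: weight_ge0.
pose Q (cd : 'I_n.+1 * 'I_m.+1) (a : R) : Prop :=
  k <= psum alpha cd.1 + psum beta cd.2 \/
  forall U V, U \is unitarymx -> V \is unitarymx -> a <= bs cd.1 cd.2 U V.
have [|[c d]|a a0 aQ] := @finite_common_gt0 _ Q.
- move=> cd a b ba [h|h]; [by left|right => U V Uu Vu].
  by apply: le_trans ba _; exact: h.
- have [|U [V [x [y [z [[Uu Vu _ _ _] bmin]]]]]] :=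
    @param_box_min R m n 0 (fun U V _ _ _ => bs c d U V) (lexx 0).
    apply: continuous_sumf => j; apply: continuous_sumf => i.
    apply: continuous_weight; [exact: mcontinuous_U|exact: mcontinuous_V].
  have := bs_ge0 c d U V; rewrite le_eqVlt => /orP[/eqP bs0|bs_gt0].
    exists 1 => //; left => /=; apply: (scalable_zero_block sc Uu Vu).
    + by rewrite -ltnS.
    + by rewrite -ltnS.
    + move=> l j i dj ci; apply: normsq_eq0.
      have wj : forall j : 'I_m, (d <= j)%N ->
          \sum_(i < n | (c <= i)%N) weight A U V j i = 0.
        apply: psumr_eq0P; last exact: esym bs0.
        by move=> j' _; apply: sumr_ge0 => i' _; exact: weight_ge0.
      have wi : forall i : 'I_n, (c <= i)%N -> weight A U V j i = 0.
        by apply: psumr_eq0P (wj j dj) => i' _; exact: weight_ge0.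
      have wl : forall l, true -> normsq (cp_scaling V U A l j i) = 0.
        by apply: psumr_eq0P (wi i ci) => l' _; exact: normsq_ge0.
      exact: wl.
  exists (bs c d U V) => //; right => U' V' Uu' Vu' /=.
  apply: (bmin U' V' 0 0 0); split => //.
  + by move=> i j _; rewrite !mxE.
  + by move=> i j _; rewrite !mxE.
  + by split => [i|j|]; rewrite ?mxE lexx.
- exists a => // c d cn dm.
  by have := aQ (Ordinal (cn : (c < n.+1)%N), Ordinal (dm : (d < m.+1)%N)).
Qed.

Hypothesis k_ge0 : 0 <= k.

Lemma scalable_cap_bounded : cp_scalable k A alpha beta ->
  exists b, forall q, cap_domain q -> b <= cap_obj k A alpha beta q.
Proof.
move=> sc; have [P0 Q0] := scalable_psum_ge0 sc.
have [delta delta0 gap] := block_weight_gap sc.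
(* Chosen so that [2 * W / delta = W / (k + 1) * a]; then [ln u <= u] at [u = W / (k + 1)] gives
   [k * M <= W + k * ln a] for the [M] below. *)
pose a := 2 * (k + 1) / delta.
have a0 : 0 < a by rewrite divr_gt0// mulr_gt0// ltr_wpDl.
exists (- `|k * ln a|) => q /cap_domainP[U [V [x [y [z [Uu Vu xn yn [x0 y0 z0 ->]]]]]]].
rewrite cap_objE//.
set W := \sum_j _.
have W0 : 0 <= W.
  apply: sumr_ge0 => j _; apply: sumr_ge0 => i _.
  by rewrite mulr_ge0 ?weight_ge0 ?expR_ge0.
have ax := dotr_abel xn x0 P0; have by_ := dotr_abel yn y0 Q0.
have key M : M <= z -> W < delta * expR M -> k * (z - M) <= dotr alpha x + dotr beta y.
  move=> Mz WM; apply: layers_le_dotr => //; first by rewrite subr_ge0.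
  move=> c d t cn dm cE dE; have [//|h] := gap c d cn dm.
  have : W < W; last by rewrite ltxx.
  apply: lt_le_trans WM _.
  (* On the block [x_i < t] and [y_j < z - M - t], so the exponent exceeds [M]; the block alone
     would contribute at least [delta * expR M > W]. *)
  apply: (@le_trans _ _ (\sum_(j < m | (d <= j)%N) \sum_(i < n | (c <= i)%N)
      weight A U V j i * expR M)).
    under eq_bigr do rewrite -mulr_suml.
    by rewrite -mulr_suml ler_wpM2r ?expR_ge0// h.
  rewrite big_mkcond ler_sum// => j _; case: ifP => dj; last first.
    by apply: sumr_ge0 => i _; rewrite mulr_ge0 ?weight_ge0 ?expR_ge0.
  rewrite big_mkcond ler_sum// => i _; case: ifP => ci; last first.
    by rewrite mulr_ge0 ?weight_ge0 ?expR_ge0.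
  rewrite ler_wpM2l ?weight_ge0// ler_expR.
  have := cE i; rewrite ltnNge ci /= => /esym/negbT; rewrite -ltNge.
  have := dE j; rewrite ltnNge dj /= => /esym/negbT; rewrite -ltNge.
  lra.
have nk : - `|k * ln a| <= 0 by rewrite oppr_le0 normr_ge0.
(* When [W = 0] the logarithm of [W] is of no use; [key] at [M = 0] shows directly that the
   objective is nonnegative. *)
move: W0; rewrite le_eqVlt => /orP[/eqP W0|W_gt0].
  have := key 0 z0; rewrite -W0 expR0 mulr1 subr0 => /(_ delta0); lra.
(* The factor [2] makes the inequality [W < delta * expR M] strict. *)
pose M := ln (2 * W / delta).
have MW : delta * expR M = 2 * W.
  rewrite lnK ?posrE ?divr_gt0// ?mulr_gt0//; field; exact: lt0r_neq0.
have k1 : 0 < k + 1 by rewrite ltr_wpDl.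
have Wk : 0 < W / (k + 1) by rewrite divr_gt0.
have kM : k * M <= W + k * ln a.
  have -> : M = ln (W / (k + 1)) + ln a.
    rewrite -lnM ?posrE// /M; congr ln.
    by rewrite /a; field; rewrite !lt0r_neq0.
  rewrite mulrDr lerD2r.
  have lnW : ln (W / (k + 1)) <= W / (k + 1) by rewrite ltW// ln_sublinear.
  apply: le_trans (ler_wpM2l k_ge0 lnW) _.
  rewrite -[leRHS](divfK (lt0r_neq0 k1)) mulrC ler_wpM2l ?(ltW Wk)//.
  by rewrite lerDl.
have ka : k * ln a <= `|k * ln a| by exact: ler_norm.
(* For [z < M] the bound [k * z <= k * M] and the nonnegativity of both [dotr] terms are enough. *)
have [Mz|zM] := leP M z.
  have := key M Mz; rewrite MW => /(_ _); lra.
have : k * z <= k * M by rewrite ler_wpM2l// ltW.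
lra.
Qed.

End ScalableBounded.

(** * Minimizers of the capacity give scalings *)

Section MinimizerScaling.
Variable R : realType.
Local Notation C := R[i].
Variables m n p : nat.
Variables (A : 'I_p -> 'M[C]_(m, n)) (alpha : 'rV[R]_n) (beta : 'rV[R]_m).
Hypothesis alpha_noninc : nonincreasing_vec alpha.
Hypothesis beta_noninc : nonincreasing_vec beta.

Lemma Re_realM (a : R) (w : C) : complex.Re (a%:C * w) = a * complex.Re w.
Proof. by case: w => x y; rewrite /= mul0r subr0. Qed.

(** Again a comparison of slopes, now at [h = 0]. From [expR h <= 1 / (1 - h)] one gets
    [kappa * (1 - h) <= S], which fails when [kappa * h] is half of [kappa - S > 0]. *)
Lemma le_of_exp_growth (kappa S : R) : 0 <= S ->
  (forall h, 0 < h -> kappa * h <= S * (expR h - 1)) -> kappa <= S.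
Proof.
move=> S0 H; rewrite leNgt; apply/negP => Sk.
have k0 : 0 < kappa by apply: le_lt_trans Sk.
pose h := (kappa - S) / (2 * kappa).
have hk : h * (2 * kappa) = kappa - S.
  by rewrite /h divfK// lt0r_neq0// mulr_gt0.
have h0 : 0 < h by rewrite divr_gt0 ?subr_gt0// mulr_gt0.
have h1 : 0 < 1 - h by nra.
have eh : expR h * (1 - h) <= 1.
  have := expR_ge1Dx (- h); rewrite expRN => e1.
  have := ler_wpM2l (expR_ge0 h) e1.
  by rewrite mulfV// gt_eqF ?expR_gt0.
have := H h h0; move: (expR h) eh => e eh He.
have : kappa * h * (1 - h) <= S * (e - 1) * (1 - h) by rewrite ler_wpM2r// ltW.
have : S * (e * (1 - h)) <= S * 1 by rewrite ler_wpM2l.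
have -> : S * (e - 1) * (1 - h) = S * (e * (1 - h)) - S + S * h by ring.
move: (S * (e * (1 - h))) => Se h2 h3.
have : kappa * h * (1 - h) <= S * h by lra.
rewrite mulrAC ler_pM2r//; nra.
Qed.

Fact objective_le_left (S S' a a' b t : R) :
  S + a + b - t <= S' + a' + b - t -> S + a <= S' + a'.
Proof. lra. Qed.

Fact objective_le_right (S S' a b b' t : R) :
  S + a + b - t <= S' + a + b' - t -> S + b <= S' + b'.
Proof. lra. Qed.

Fact objective_le_shift (S a b k z e h : R) :
  S + a + b - k * z <= S * e + a + b - k * (z + h) -> k * h <= S * (e - 1).
Proof. lra. Qed.

Lemma minimizer_scaling kappa (X DX : 'M[C]_n) (Y DY : 'M[C]_m) z :
  cap_domain (X, Y, z) ->
  (forall q, cap_domain q ->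
     cap_obj kappa A alpha beta (X, Y, z) <= cap_obj kappa A alpha beta q) ->
  DX \in unitmx -> DX^t* *m DX = invmx X ->
  DY \in unitmx -> DY^t* *m DY = invmx Y ->
  exists (B : 'M[C]_m) (D : 'M[C]_n),
    [/\ B \in unitmx, D \in unitmx,
        majorized_by (cp_scaling B D A) alpha beta &
        kappa <= cp_size (cp_scaling B D A)].
Proof.
move=> [/= Xh Yh X1 Y1 z0] opt DXu DXE DYu DYE.
(* The whole factor [expR z] goes into [B], so that the size of the scaled map equals the trace term
   of the objective at the minimizer. *)
pose r : C := (expR (z / 2))%:C.
have r0 : r != 0.
  rewrite /r -(rmorph0 (real_complex R)) (inj_eq (@complexI R)).
  by rewrite gt_eqF ?expR_gt0.
have rr : r * r = (expR z)%:C.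
  by rewrite -rmorphM -expRD; congr (expR _)%:C; field.
have rJ : Num.conj r = r by exact: conjc_real.
pose B := r *: DY.
have BB : B^t* *m B = (expR z)%:C *: invmx Y.
  by rewrite /B trmxCZ rJ -scalemxAl -scalemxAr scalerA DYE rr.
have iXh : invmx X \is hermsymmx.
  by apply/hermsymmxP; rewrite -DXE trmxC_mul trmxCK.
have eYh : (expR z)%:C *: invmx Y \is hermsymmx.
  by apply/hermsymmxP; rewrite -BB trmxC_mul trmxCK.
have trY (M : 'M[C]_n) : complex.Re (\tr (cp_map A M *m ((expR z)%:C *: invmx Y))) =
    complex.Re (\tr (cp_map A M *m invmx Y)) * expR z.
  by rewrite -scalemxAr mxtraceZ Re_realM mulrC.
have sizeE : cp_size (cp_scaling B DX A) =
    complex.Re (\tr (cp_map A (invmx X) *m invmx Y)) * expR z.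
  rewrite /cp_size cp_map_scaling DXE mxtrace_mulC mulmxA BB -trY.
  by rewrite mxtrace_mulC.
exists B, DX; split => //.
- by rewrite /B unitmxZ// unitfE.
- split.
    rewrite cp_adjoint_scaling BB.
    apply: (optimal_majorized alpha_noninc (cp_adjoint_herm A eYh) Xh X1 DXu DXE).
    have trN (M : 'M[C]_n) :
        complex.Re (\tr (cp_adjoint A ((expR z)%:C *: invmx Y) *m M)) =
        complex.Re (\tr (cp_map A M *m invmx Y)) * expR z.
      by rewrite -trace_cp_adjoint trY.
    move=> X' X'h X'1; rewrite (trN (invmx X)) (trN (invmx X')).
    have dom : cap_domain (X', Y, z) by split.
    have := opt _ dom; rewrite /cap_obj; exact: objective_le_left.
  rewrite cp_map_scaling DXE.
  have -> : B *m cp_map A (invmx X) *m B^t* =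
      DY *m ((expR z)%:C *: cp_map A (invmx X)) *m DY^t*.
    by rewrite /B trmxCZ rJ -!scalemxAl -!scalemxAr -!scalemxAl scalerA rr.
  have hN : (expR z)%:C *: cp_map A (invmx X) \is hermsymmx.
    apply/hermsymmxP; rewrite trmxCZ (hermsymmxP _ (cp_map_herm A iXh)).
    by congr (_ *: _); exact: conjc_real.
  apply: (optimal_majorized beta_noninc hN Yh Y1 DYu DYE).
  have trN (M : 'M[C]_m) :
      complex.Re (\tr ((expR z)%:C *: cp_map A (invmx X) *m M)) =
      complex.Re (\tr (cp_map A (invmx X) *m M)) * expR z.
    by rewrite -scalemxAl mxtraceZ Re_realM mulrC.
  move=> Y' Y'h Y'1; rewrite (trN (invmx Y)) (trN (invmx Y')).
  have dom : cap_domain (X, Y', z) by split.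
  have := opt _ dom; rewrite /cap_obj; exact: objective_le_right.
- have S0 : 0 <= cp_size (cp_scaling B DX A).
    rewrite cp_sizeE; apply: sumr_ge0 => j _; apply: sumr_ge0 => l _.
    by apply: sumr_ge0 => i _; exact: normsq_ge0.
  (* Only increases of [z] are sure to stay in the domain, hence a one-sided bound on the size. *)
  apply: le_of_exp_growth => // h h0.
  have dom : cap_domain (X, Y, z + h) by split => //=; rewrite addr_ge0// ltW.
  have := opt _ dom; rewrite /cap_obj sizeE expRD mulrA.
  exact: objective_le_shift.
Qed.

Lemma invmx_exp_udiag_factor d (U : 'M[C]_d) (x : 'rV[R]_d) : U \is unitarymx ->
  exists2 D : 'M[C]_d, D \in unitmx & D^t* *m D = invmx (udiag U (map_mx expR x)).
Proof.
move=> Uu; rewrite udiag_inv//; last by move=> i; rewrite mxE gt_eqF ?expR_gt0.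
pose s : 'rV[R]_d := \row_i expR (- x 0 i / 2).
exists (udiag U s); last first.
  have /hermsymmxP -> := udiag_herm U s; rewrite (udiagM _ _ Uu); congr udiag.
  by apply/rowP => i; rewrite !mxE -expRD -expRN; congr expR; field.
have [|u _] := @mulmx1_unit _ _ (udiag U s) (udiag U (\row_i (s 0 i)^-1)) => //.
rewrite udiagM// -(udiag1 Uu); congr udiag.
by apply/rowP => i; rewrite !mxE mulfV// gt_eqF ?expR_gt0.
Qed.

End MinimizerScaling.

(** * Rays, coercivity and the degenerate case *)

Section BoundedScalable.
Variable R : realType.
Local Notation C := R[i].

(** If the last of the first [s] entries is positive, all of them are; otherwise the remaining
    entries are nonpositive and [psum a d <= psum a s]. *)
Lemma psum_gt0 d (a : 'rV[R]_d) s : nonincreasing_vec a -> 0 < psum a d ->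
  (0 < s <= d)%N -> 0 < psum a s.
Proof.
case: s => // s an ad /= sd; have [as0|as0] := ltP 0 (a 0 (Ordinal sd)).
  have ge_as (i : 'I_d) : (i < s.+1)%N -> a 0 (Ordinal sd) <= a 0 i.
    by move=> is_; apply: an.
  rewrite /psum (bigD1 (Ordinal sd))//= ltr_pwDl// sumr_ge0// => i /andP[is_ _].
  by apply: ltW; apply: lt_le_trans (ge_as i is_).
apply: lt_le_trans ad _; rewrite psum_full /psum [leRHS]big_mkcond ler_sum// => i _.
case: ltnP => // si; apply: le_trans as0; apply: an; exact: ltnW.
Qed.

Variables m n p : nat.
Variables (A : 'I_p -> 'M[C]_(m, n)) (alpha : 'rV[R]_n) (beta : 'rV[R]_m) (k : R).
Hypothesis alpha_noninc : nonincreasing_vec alpha.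
Hypothesis beta_noninc : nonincreasing_vec beta.

Variable b : R.
Hypothesis cap_ge : forall q, cap_domain q -> b <= cap_obj k A alpha beta q.

(** The value of the objective at [X = 1], [Y = 1], [z = 0]. *)
Let W0 := \sum_j \sum_i weight A 1%:M 1%:M j i.

(** Along the ray with [x] and [y] equal to [t] on their heads and [z = t * theta], no exponent is
    positive, so the exponential term stays below [W0] and the linear part must not decrease. *)
Lemma cap_bounded_ray s r (theta : R) : (s <= n)%N -> (r <= m)%N -> 0 <= theta ->
  (forall (i : 'I_n) (j : 'I_m), theta <= (i < s)%N%:R + (j < r)%N%:R) ->
  k * theta <= psum alpha s + psum beta r.
Proof.
move=> sn rm theta0 theta_le.
have ray t : 0 <= t -> b <= W0 + t * (psum alpha s + psum beta r - k * theta).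
  move=> t0.
  pose x : 'rV[R]_n := \row_i (if (i < s)%N then t else 0).
  pose y : 'rV[R]_m := \row_j (if (j < r)%N then t else 0).
  have head_noninc d u : nonincreasing_vec (\row_(i < d) (if (i < u)%N then t else 0)).
    move=> i j ij; rewrite !mxE; case: ifP => [ju|_]; last by case: ifP.
    by rewrite (leq_ltn_trans ij ju).
  have xn : nonincreasing_vec x by exact: head_noninc.
  have yn : nonincreasing_vec y by exact: head_noninc.
  have u1 d : (1%:M : 'M[C]_d) \is unitarymx by exact: unitary1.
  have := cap_ge (@cap_domain_udiag R m n 1%:M 1%:M x y (t * theta) _ _ _ _ _).
  rewrite cap_objE// => /(_ (u1 _) (u1 _)) h.
  apply: le_trans (h _ _ _) _.
  - by move=> i; rewrite mxE; case: ifP.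
  - by move=> j; rewrite mxE; case: ifP.
  - exact: mulr_ge0.
  have -> : dotr alpha x = t * psum alpha s.
    by apply: psum_indicator => i; rewrite mxE.
  have -> : dotr beta y = t * psum beta r.
    by apply: psum_indicator => i; rewrite mxE.
  suff : \sum_j \sum_i weight A 1%:M 1%:M j i * expR (t * theta - x 0 i - y 0 j) <= W0.
    move: (\sum_j _) => W; lra.
  apply: ler_sum => j _; apply: ler_sum => i _.
  rewrite -[leRHS]mulr1 ler_wpM2l ?weight_ge0// -expR0 ler_expR !mxE.
  have := ler_wpM2l t0 (theta_le i j).
  by case: ltnP => _; case: ltnP => _ /=; lra.
rewrite leNgt; apply/negP => lt_theta.
have e0 : 0 < k * theta - (psum alpha s + psum beta r) by rewrite subr_gt0.
have bW : b <= W0 by have := ray 0 (lexx 0); rewrite mul0r addr0.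
(* At this time the ray bound would read [b <= b - 1]. *)
have t0 : 0 <= (W0 - b + 1) / (k * theta - (psum alpha s + psum beta r)).
  by rewrite divr_ge0 ?(ltW e0)//; lra.
have := ray _ t0; rewrite -[_ + _ - k * theta]opprB mulrN divfK ?lt0r_neq0//; lra.
Qed.

Lemma cap_bounded_psum :
  [/\ forall s, (s <= n)%N -> 0 <= psum alpha s,
      forall s, (s <= m)%N -> 0 <= psum beta s,
      k <= psum alpha n & k <= psum beta m].
Proof.
have nat_ge0 (c d : bool) : 0 <= (c%:R + d%:R : R) by rewrite addr_ge0.
split => [s sd|s sd||].
- by have := @cap_bounded_ray s 0 0 sd (leq0n _) (lexx 0) (fun i j => nat_ge0 _ _);
    rewrite mulr0 psum0 addr0.
- by have := @cap_bounded_ray 0 s 0 (leq0n _) sd (lexx 0) (fun i j => nat_ge0 _ _);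
    rewrite mulr0 psum0 add0r.
- have := @cap_bounded_ray n 0 1 (leqnn _) (leq0n _) ler01.
  rewrite mulr1 psum0 addr0; apply => i j.
  by rewrite ltn_ord addr0.
- have := @cap_bounded_ray 0 m 1 (leq0n _) (leqnn _) ler01.
  rewrite mulr1 psum0 add0r; apply => i j.
  by rewrite ltn_ord add0r.
Qed.

Lemma psum_common_bound d (a : 'rV[R]_d) : nonincreasing_vec a -> 0 < psum a d ->
  exists2 c, 0 < c & forall s, (0 < s <= d)%N -> c <= psum a s.
Proof.
move=> an ad.
have [|i|c c0 cP] := @finite_common_gt0 R 'I_d (fun i c => c <= psum a i.+1).
- by move=> i x y yx xa; apply: le_trans xa.
- by exists (psum a i.+1) => //; apply: psum_gt0 => //=.
- by exists c => // -[//|s] /= sd; exact: (cP (Ordinal sd)).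
Qed.

Lemma cap_minimizer eps : 0 < eps -> 0 < psum alpha n -> 0 < psum beta m ->
  exists U V x y z,
    [/\ U \is unitarymx, V \is unitarymx &
        let q := (udiag U (map_mx expR x), udiag V (map_mx expR y), z) in
        cap_domain q /\ forall q', cap_domain q' ->
        cap_obj (k - eps) A alpha beta q <= cap_obj (k - eps) A alpha beta q'].
Proof.
move=> eps0 Pn Qm; pose kappa := k - eps.
have [P0 Q0 _ _] := cap_bounded_psum.
have [ca ca0 caP] := psum_common_bound alpha_noninc Pn.
have [cb cb0 cbP] := psum_common_bound beta_noninc Qm.
pose f U V (x : 'rV[R]_n) (y : 'rV[R]_m) z : R :=
  \sum_j \sum_i weight A U V j i * expR (z + - x 0 i + - y 0 j)
  + dotr alpha x + dotr beta y + - (kappa * z).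
have fE U V x y z : U \is unitarymx -> V \is unitarymx -> nonincreasing_vec x ->
    nonincreasing_vec y -> cap_obj kappa A alpha beta
      (udiag U (map_mx expR x), udiag V (map_mx expR y), z) = f U V x y z.
  by move=> *; rewrite cap_objE.
have f0 : f 1%:M 1%:M 0 0 0 = W0.
  have dotr0 d (v : 'rV[R]_d) : dotr v 0 = 0.
    by rewrite /dotr big1// => i _; rewrite mxE mulr0.
  rewrite /f mulr0 oppr0 !dotr0 !addr0; apply: eq_bigr => j _; apply: eq_bigr => i _.
  by rewrite !mxE oppr0 !addr0 expR0 mulr1.
(* On the sublevel set of [W0], adding [eps * z] to an objective bounded below by [b] forces
   [z <= Z]. Then each [dotr] term is at most [X1], and [dotr_ge_entry] bounds the entries of [x]
   and [y]. *)
pose Z := (W0 - b) / eps.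
pose X1 := W0 + `|kappa| * Z.
have W_ge0 : 0 <= W0.
  by apply: sumr_ge0 => j _; apply: sumr_ge0 => i _; exact: weight_ge0.
have bW : b <= W0.
  have := @cap_ge (udiag 1%:M (map_mx expR 0), udiag 1%:M (map_mx expR 0), 0).
  have n0 d : nonincreasing_vec (0 : 'rV[R]_d) by move=> i j _; rewrite !mxE.
  have -> : cap_obj k A alpha beta
      (udiag 1%:M (map_mx expR 0), udiag 1%:M (map_mx expR 0), 0)
      = f 1%:M 1%:M 0 0 0.
    by rewrite cap_objE ?unitary1// /f !mulr0.
  rewrite f0; apply; apply: cap_domain_udiag; rewrite ?unitary1// => i; by rewrite mxE.
have Z0 : 0 <= Z by rewrite divr_ge0 ?subr_ge0// ltW.
have X10 : 0 <= X1 by rewrite addr_ge0// mulr_ge0.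
pose bb := Z + X1 / ca + X1 / cb.
have bb0 : 0 <= bb by rewrite !addr_ge0// divr_ge0// ltW.
have box0 : param_box bb (1%:M : 'M[C]_n) (1%:M : 'M[C]_m) 0 0 0.
  split; rewrite ?unitary1//; last by split => [i|j|]; rewrite ?mxE lexx bb0.
    by move=> i j _; rewrite !mxE.
  by move=> i j _; rewrite !mxE.
have fc : continuous (fun w : params R m n =>
    f (param_U w) (param_V w) (param_x w) (param_y w) (param_z w)).
  have zc : continuous (fun w : params R m n => param_z w) by exact: continuous_coord.
  rewrite /f; apply: continuous_addf; last first.
    by apply: continuous_oppf; apply: continuous_mulf => //; exact: continuous_constf.
  apply: continuous_addf; last first.
    apply: continuous_sumf => j; apply: continuous_mulf; first exact: continuous_constf.
    exact: continuous_y.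
  apply: continuous_addf; last first.
    apply: continuous_sumf => i; apply: continuous_mulf; first exact: continuous_constf.
    exact: continuous_x.
  apply: continuous_sumf => j; apply: continuous_sumf => i; apply: continuous_mulf.
    by apply: continuous_weight; [exact: mcontinuous_U|exact: mcontinuous_V].
  apply: continuous_expf; apply: continuous_addf; last first.
    by apply: continuous_oppf; exact: continuous_y.
  by apply: continuous_addf => //; apply: continuous_oppf; exact: continuous_x.
have [U [V [x [y [z [[Uu Vu xn yn [xb yb zb]] fmin]]]]]] := param_box_min bb0 fc.
exists U, V, x, y, z; split => //; split.
  apply: cap_domain_udiag => // [i|j|]; first by case/andP: (xb i).
    by case/andP: (yb j).
  by case/andP: zb.
rewrite -/kappa fE// => q' q'dom.
have := cap_ge q'dom.
have [U' [V' [x' [y' [z' [Uu' Vu' xn' yn' [x0 y0 z0 ->]]]]]]] := cap_domainP q'dom.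
rewrite fE// cap_objE//.
have ax := dotr_abel xn' x0 P0; have by_ := dotr_abel yn' y0 Q0.
have xi i := dotr_ge_entry (ltW ca0) xn' x0 caP i.
have yi i := dotr_ge_entry (ltW cb0) yn' y0 cbP i.
(* Points above the level [W0] are beaten by the origin, which lies in the box; the others lie in
   the box themselves. *)
have [le_W|lt_W] := leP (f U' V' x' y' z') W0; last first.
  by move=> _; apply: le_trans (ltW lt_W); rewrite -f0; exact: fmin.
move=> hb; apply: fmin; split => //.
move: hb le_W; rewrite /f.
set W := \sum_j _.
have W0' : 0 <= W.
  apply: sumr_ge0 => j _; apply: sumr_ge0 => i _.
  by rewrite mulr_ge0 ?weight_ge0 ?expR_ge0.
move=> hb le_W.
have zZ : z' <= Z.
  rewrite ler_pdivlMr//; move: hb le_W; rewrite /kappa; lra.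
have kz : kappa * z' <= `|kappa| * Z.
  apply: (@le_trans _ _ (`|kappa| * z')); first by rewrite ler_wpM2r// ler_norm.
  by rewrite ler_wpM2l.
have d1 : 0 <= X1 / ca by rewrite divr_ge0// ltW.
have d2 : 0 <= X1 / cb by rewrite divr_ge0// ltW.
split => [i|j|].
- rewrite x0/=; apply: (@le_trans _ _ (X1 / ca)); last by rewrite /bb; lra.
  rewrite ler_pdivlMr// mulrC; apply: le_trans (xi i) _; rewrite /X1; lra.
- rewrite y0/=; apply: (@le_trans _ _ (X1 / cb)); last by rewrite /bb; lra.
  rewrite ler_pdivlMr// mulrC; apply: le_trans (yi j) _; rewrite /X1; lra.
- rewrite z0/=; apply: le_trans zZ _; rewrite /bb; lra.
Qed.

Lemma zero_scalable : k = 0 -> (forall X, cp_map A X = 0) -> cp_scalable k A alpha beta.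
Proof.
move=> k0 A0 eps eps0; have [P0 Q0 _ _] := cap_bounded_psum.
have Ap0 : cp_map (cp_scaling 1%:M 1%:M A) 1%:M = 0.
  by rewrite cp_map_scaling A0 mulmx0 mul0mx.
have size0 : cp_size (cp_scaling 1%:M 1%:M A) = 0.
  by rewrite /cp_size Ap0 mxtrace0.
(* The adjoint vanishes too: pairing it with matrix units reads off its entries, and trace duality
   turns each pairing into one with [cp_map A]. *)
have Aa0 : cp_adjoint (cp_scaling 1%:M 1%:M A) 1%:M = 0.
  rewrite cp_adjoint_scaling; set N := cp_adjoint A _.
  suff -> : N = 0 by rewrite mulmx0 mul0mx.
  apply/matrixP => i j; rewrite [RHS]mxE.
  have : \tr (N *m delta_mx j i) = 0.
    by rewrite /N -trace_cp_adjoint A0 mul0mx mxtrace0.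
  rewrite /mxtrace (bigD1 i)//= big1 ?addr0.
    rewrite mxE (bigD1 j)//= big1 ?addr0; first by rewrite mxE !eqxx mulr1.
    by move=> l lj; rewrite mxE (negbTE lj) mulr0.
  move=> l li; rewrite mxE big1// => l' _.
  by rewrite mxE (negbTE li) andbF mulr0.
have eig0 d : eigvals (0 : 'M[C]_d) = 0.
  have -> : (0 : 'M[C]_d) = udiag 1%:M 0.
    by rewrite udiagE map_mx0 linear0 mulmx0 mul0mx.
  by apply: eigvals_udiag; [exact: unitary1|move=> i j _; rewrite !mxE].
have psum00 d s : psum (0 : 'rV[R]_d) s = 0.
  by rewrite /psum big1// => i _; rewrite mxE.
have n0 d : nonincreasing_vec (0 : 'rV[R]_d) by move=> i j _; rewrite !mxE.
exists 1%:M, 1%:M; split; rewrite ?unitmx1//; last first.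
  by rewrite size0 k0 sub0r oppr_le0 ltW.
rewrite /majorized_by Aa0 Ap0 !eig0; split; apply/weakly_majorized_psum => // s sd;
  rewrite psum00; [exact: P0|exact: Q0].
Qed.

Lemma cap_bounded_scalable : 0 <= k ->
  (k = 0 -> (forall X, cp_map A X = 0) \/
     (\sum_(i < n) alpha 0 i <> 0 /\ \sum_(j < m) beta 0 j <> 0)) ->
  cp_scalable k A alpha beta.
Proof.
move=> k0 nondeg; have [P0 Q0 kP kQ] := cap_bounded_psum.
have pos : (0 < psum alpha n) && (0 < psum beta m) -> cp_scalable k A alpha beta.
  move=> /andP[Pn Qm] eps eps0.
  have [U [V [x [y [z [Uu Vu [dom opt]]]]]]] := cap_minimizer eps0 Pn Qm.
  have [DX DXu DXE] := invmx_exp_udiag_factor x Uu.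
  have [DY DYu DYE] := invmx_exp_udiag_factor y Vu.
  exact: (minimizer_scaling alpha_noninc beta_noninc dom opt DXu DXE DYu DYE).
have [/pos//|] := boolP ((0 < psum alpha n) && (0 < psum beta m)).
rewrite negb_and -!leNgt => degen.
(* Both total sums dominate [k], and one of them is at most [0]. *)
have kE : k = 0 by apply: le_anti; rewrite k0 andbT; case/orP: degen; exact: le_trans.
have [A0|[an bn]] := nondeg kE; first exact: zero_scalable.
rewrite -!psum_full in an bn; case/orP: degen => h.
  by case: an; apply: le_anti; rewrite h P0.
by case: bn; apply: le_anti; rewrite h Q0.
Qed.

End BoundedScalable.

Theorem theorem4p3 (R : realType) (m n p : nat)
    (A : 'I_p -> 'M[R[i]]_(m, n))
    (alpha : 'rV[R]_n) (beta : 'rV[R]_m) (k : R)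
    (alpha_noninc : nonincreasing_vec alpha)
    (beta_noninc : nonincreasing_vec beta)
    (k_ge0 : 0 <= k)
    (* needed: for k = 0, Phi = id on 1 x 1 matrices and alpha = beta = 0 the
       capacity is 0, but no invertible scaling is (0, 0)-majorized *)
    (nondegenerate : k = 0 ->
       (forall X, cp_map A X = 0) \/
       (\sum_(i < n) alpha 0 i <> 0 /\ \sum_(j < m) beta 0 j <> 0)) :
  (-oo < capacity k A alpha beta)%E <-> cp_scalable k A alpha beta.
Proof.
split => [cap_fin|sc]; last first.
  have [b bP] := scalable_cap_bounded alpha_noninc beta_noninc k_ge0 sc.
  apply: (@lt_le_trans _ _ (b%:E)); first exact: ltNyr.
  by apply/ereal_infP => _ [q qd <-]; rewrite lee_fin; exact: bP.
have [b bP] : exists b, forall q, cap_domain q -> b <= cap_obj k A alpha beta q.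
  have cap_le q : cap_domain q ->
      (capacity k A alpha beta <= (cap_obj k A alpha beta q)%:E)%E.
    by move=> qd; apply: ereal_inf_lbound; exists q.
  case E : (capacity k A alpha beta) cap_fin cap_le => [c| |] // _ cap_le.
    by exists c => q qd; rewrite -lee_fin; exact: cap_le.
  (* An infimum equal to [+oo] would lie below a real value of the objective, so this case is
     contradictory at any point of the domain. *)
  by exists 0 => q /cap_le; rewrite leye_eq.
exact: (cap_bounded_scalable alpha_noninc beta_noninc bP k_ge0 nondegenerate).
Qed.
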